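(* For every pure unit quaternion $q$, the singularities of the quotient surface $T_q/\hat{Q}_8$ are $A_1+6A_3$ (that is, the singular points are exactly one $A_1$ point and six $A_3$ points).
   Context: Let $\mathbb{H}=\mathbb{R}[1,i,j,k]$ be the quaternions, $i^2=j^2=k^2=-1$, $ij=-ji=k$. Put $t=\frac12(1+i+j+k)$ and let $\Lambda=\mathbb{Z}[1,i,j,t]$ be the ring of Hurwitz quaternions. For a pure unit quaternion $q$ (i.e. $q\in\mathbb{H}$, $q^2=-1$), right multiplication by $q$ defines a complex structure on $\mathbb{H}$, hence on the real torus $\mathbb{H}/\Lambda$; let $T_q=\mathbb{H}/\Lambda$ be the resulting complex torus of dimension 2. For $\lambda\in\Lambda^\times$ and $r\in T_q$ let $(\lambda;r)$ denote the holomorphic automorphism $x\mapsto\lambda x+r$ of $T_q$, and write $\lambda=(\lambda;0)$. Let $\alpha=\frac12(1+i)$, $j'=(j;\alpha)$, $k'=(k;\alpha)$ and $$\hat{Q}_8=\{\pm1,\pm i,\pm j',\pm k'\},$$ a group of automorphisms of $T_q$ isomorphic to the quaternion group of order 8. *)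

(* Defs.v *)
From HB Require Import structures.
From mathcomp Require Import all_boot all_order all_algebra.
From mathcomp Require Import generic_quotient.
From mathcomp Require Import all_classical all_reals all_analysis.
From mathcomp Require Import complex.
From mathcomp Require Import ring lra.

Set Implicit Arguments.
Unset Strict Implicit.
Unset Printing Implicit Defensive.

Import Order.TTheory GRing.Theory Num.Theory.
Import numFieldNormedType.Exports.

Local Open Scope classical_set_scope.
Local Open Scope ring_scope.
Local Open Scope quotient_scope.

Section RcomplexNormed.
Variable R : rcfType.

Lemma normcZ (l : R) (x : Rcomplex R) : `|l *: x| = `|l| * `|x|.
Proof.
case: x => a b; rewrite /Num.norm/= /Normc.normc /GRing.scale/=.
by rewrite !exprMn -mulrDr sqrtrM ?sqr_ge0// sqrtr_sqr.
Qed.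

HB.instance Definition _ := PseudoMetric.copy (Rcomplex R)
  (pseudoMetric_normed (Rcomplex R)).
HB.instance Definition _ := isPointed.Build (Rcomplex R) 0.
HB.instance Definition _ := NormedZmod_PseudoMetric_eq.Build R (Rcomplex R) erefl.
HB.instance Definition _ :=
  PseudoMetricNormedZmod_Lmodule_isNormedModule.Build R (Rcomplex R) normcZ.

End RcomplexNormed.

(* A topological space with a sheaf of complex-valued functions: [fs_hol U f]
   says that f is a section over the open set U.  Functions are total and
   their values outside U are irrelevant.  No axiom is imposed: the instances
   below are sheaves, and a reduced complex space is determined by its
   underlying space and its sheaf of holomorphic functions. *)
Record fspace (R : realType) := FSpace {
  fs_sort :> topologicalType;
  fs_hol : set fs_sort -> (fs_sort -> Rcomplex R) -> Prop }.

(* The real normed space V with the complex structure J (J^2 = -1): the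
   differential, computed over R, has to be C-linear. *)
Definition holomorphic_at (R : realType) (V : normedModType R) (J : V -> V)
    (f : V -> Rcomplex R) (x : V) : Prop :=
  differentiable f x /\
  forall v : V, 'd f x (J v) = ('i%C : Rcomplex R) * 'd f x v.

Definition flat_space (R : realType) (V : normedModType R) (J : V -> V) :
    fspace R :=
  @FSpace R V (fun U f => forall x, U x -> holomorphic_at J f x).

Record transf_group (T : Type) := TransfGroup {
  tg_set : set (T -> T);
  tg_id : tg_set id;
  tg_comp : forall g h, tg_set g -> tg_set h -> tg_set (g \o h);
  tg_inv : forall g, tg_set g ->
    exists2 h, tg_set h & cancel g h /\ cancel h g }.

Section OrbitSpace.
Variables (R : realType) (X : fspace R) (G : transf_group X).

Definition orbit_rel : rel X := fun x y => `[< exists2 g, tg_set G g & g x = y >].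

Lemma orbit_rel_refl : reflexive orbit_rel.
Proof. by move=> x; apply/asboolP; exists id => //; exact: tg_id. Qed.

Lemma orbit_rel_sym : symmetric orbit_rel.
Proof.
suff H x y : orbit_rel x y -> orbit_rel y x by move=> x y; apply/idP/idP; apply: H.
move=> /asboolP[g Gg <-]; apply/asboolP.
by have [h Gh [gK _]] := tg_inv Gg; exists h.
Qed.

Lemma orbit_rel_trans : transitive orbit_rel.
Proof.
move=> y x z /asboolP[g Gg <-] /asboolP[h Gh <-]; apply/asboolP.
by exists (h \o g) => //; exact: tg_comp.
Qed.

Definition orbit_equiv :=
  EquivRel orbit_rel orbit_rel_refl orbit_rel_sym orbit_rel_trans.

(* X/G with the quotient topology; its sheaf is the G-invariant part of the
   direct image of the sheaf of X. *)
Definition orbit_space : fspace R :=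
  @FSpace R (quotient_topology {eq_quot orbit_equiv})
    (fun U f =>
       fs_hol (\pi_({eq_quot orbit_equiv}) @^-1` U)
              (f \o \pi_({eq_quot orbit_equiv}))).

Definition orbit_pi (x : X) : orbit_space := \pi_({eq_quot orbit_equiv}) x.

Definition orbit_repr (x : orbit_space) : X :=
  repr (x : {eq_quot orbit_equiv}).

Lemma orbit_reprK : cancel orbit_repr orbit_pi.
Proof. exact: reprK. Qed.

Lemma orbit_piP (x y : X) :
  orbit_pi x = orbit_pi y <-> exists2 g, tg_set G g & g x = y.
Proof.
split; first by move=> /eqquotP/asboolP.
by move=> H; apply/eqquotP/asboolP.
Qed.

End OrbitSpace.

(* Isomorphism of the germs (X, x) and (Y, y) of ringed spaces; phi and psi are
   only meaningful on U and V. *)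
Definition germ_iso (R : realType) (X : fspace R) (x : X) (Y : fspace R) (y : Y)
    : Prop :=
  exists (U : set X) (V : set Y) (phi : X -> Y) (psi : Y -> X),
    [/\ [/\ open U, open V, U x, V y & phi x = y],
        [/\ {homo phi : u / U u >-> V u}, {homo psi : v / V v >-> U v},
            (forall u, U u -> psi (phi u) = u) &
            (forall v, V v -> phi (psi v) = v)],
        (forall u, U u -> {for u, continuous phi}) /\
        (forall v, V v -> {for v, continuous psi}) &
        forall (W : set Y) (f : Y -> Rcomplex R), open W -> W `<=` V ->
          (fs_hol W f <-> fs_hol (U `&` phi @^-1` W) (f \o phi))].

Section Singularities.
Variable R : realType.

Definition C2 : fspace R :=
  @flat_space R (Rcomplex R * Rcomplex R)%type
    (fun p => (('i%C : Rcomplex R) * p.1, ('i%C : Rcomplex R) * p.2)).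

Definition diag_act (z : Rcomplex R) (p : C2) : C2 := (z * p.1, z^-1 * p.2).

Definition mu_set (n : nat) : set (C2 -> C2) :=
  [set g | exists2 z : Rcomplex R, z ^+ n.+1 = 1 & g = diag_act z].

Lemma mu_id n : mu_set n id.
Proof.
by exists 1; rewrite ?expr1n//; apply/funext => -[a b]; rewrite /diag_act/= invr1 !mul1r.
Qed.

Lemma mu_comp n g h : mu_set n g -> mu_set n h -> mu_set n (g \o h).
Proof.
move=> [z z1 ->] [w w1 ->]; exists (z * w); first by rewrite exprMn z1 w1 mulr1.
by apply/funext => -[a b]; rewrite /diag_act/= invfM !mulrA.
Qed.

Lemma mu_inv n g : mu_set n g ->
  exists2 h, mu_set n h & cancel g h /\ cancel h g.
Proof.
move=> [z z1 ->].
have z0 : z != 0.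
  by apply: contra_eq_neq z1 => ->; rewrite expr0n/= eq_sym oner_neq0.
exists (diag_act z^-1); first by exists z^-1 => //; rewrite exprVn z1 invr1.
by split=> -[a b]; rewrite /diag_act/= invrK !mulrA ?mulVf ?mulfV// !mul1r.
Qed.

(* The group of (n+1)-st roots of unity in SL_2, z acting by diag(z, z^-1). *)
Definition mu (n : nat) : transf_group C2 :=
  TransfGroup (mu_id n) (@mu_comp n) (@mu_inv n).

Definition smooth_point (X : fspace R) (x : X) : Prop :=
  germ_iso x ((0, 0) : C2).

Definition singular_point (X : fspace R) (x : X) : Prop := ~ smooth_point x.

(* The A_n singularity is the germ at the origin of C^2/mu_{n+1}. *)
Definition A_point (n : nat) (X : fspace R) (x : X) : Prop :=
  germ_iso x (orbit_pi (mu n) (0, 0)).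

End Singularities.

Section Quaternions.
Variable R : realType.

(* Coordinates in the basis 1, i, j, k. *)
Definition quat := 'rV[R]_4.

Definition Quat (a b c d : R) : quat := \row_(l < 4) [:: a; b; c; d]`_l.

Definition qco (x : quat) (l : nat) : R := x ord0 (inord l).

Definition qmul (x y : quat) : quat :=
  let: (a, b, c, d) := (qco x 0, qco x 1, qco x 2, qco x 3) in
  let: (a', b', c', d') := (qco y 0, qco y 1, qco y 2, qco y 3) in
  Quat (a * a' - b * b' - c * c' - d * d')
       (a * b' + b * a' + c * d' - d * c')
       (a * c' - b * d' + c * a' + d * b')
       (a * d' + b * c' - c * b' + d * a').

Definition q1 : quat := Quat 1 0 0 0.
Definition qi : quat := Quat 0 1 0 0.
Definition qj : quat := Quat 0 0 1 0.
Definition qk : quat := Quat 0 0 0 1.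
Definition qt : quat := 2^-1 *: (q1 + qi + qj + qk).
Definition qalpha : quat := 2^-1 *: (q1 + qi).

Definition hurwitz : set quat :=
  [set x | exists a b c d : int,
     x = a%:~R *: q1 + b%:~R *: qi + c%:~R *: qj + d%:~R *: qt].

Lemma qcoE a b c d : [/\ qco (Quat a b c d) 0 = a, qco (Quat a b c d) 1 = b,
  qco (Quat a b c d) 2 = c & qco (Quat a b c d) 3 = d].
Proof. by rewrite /qco !mxE !inordK. Qed.

Lemma quatP (x y : quat) : qco x 0 = qco y 0 -> qco x 1 = qco y 1 ->
  qco x 2 = qco y 2 -> qco x 3 = qco y 3 -> x = y.
Proof.
move=> h0 h1 h2 h3; apply/rowP => l; rewrite -(inord_val l).
by case: l => -[|[|[|[|//]]]].
Qed.

Lemma quatE (x : quat) : x = Quat (qco x 0) (qco x 1) (qco x 2) (qco x 3).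
Proof.
by have [h0 h1 h2 h3] := qcoE (qco x 0) (qco x 1) (qco x 2) (qco x 3);
  apply: quatP.
Qed.

Lemma quatD a b c d a' b' c' d' :
  Quat a b c d + Quat a' b' c' d' = Quat (a + a') (b + b') (c + c') (d + d').
Proof. by apply/rowP => -[[|[|[|[|//]]]] ?]; rewrite !mxE. Qed.

Lemma quatN a b c d : - Quat a b c d = Quat (- a) (- b) (- c) (- d).
Proof. by apply/rowP => -[[|[|[|[|//]]]] ?]; rewrite !mxE. Qed.

Lemma quatZ e a b c d : e *: Quat a b c d = Quat (e * a) (e * b) (e * c) (e * d).
Proof. by apply/rowP => -[[|[|[|[|//]]]] ?]; rewrite !mxE. Qed.

Lemma qmulE a b c d a' b' c' d' : qmul (Quat a b c d) (Quat a' b' c' d') =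
  Quat (a * a' - b * b' - c * c' - d * d')
       (a * b' + b * a' + c * d' - d * c')
       (a * c' - b * d' + c * a' + d * b')
       (a * d' + b * c' - c * b' + d * a').
Proof.
rewrite /qmul; have [-> -> -> ->] := qcoE a b c d.
by have [-> -> -> ->] := qcoE a' b' c' d'.
Qed.

Lemma qmulA x y z : qmul x (qmul y z) = qmul (qmul x y) z.
Proof.
by rewrite (quatE x) (quatE y) (quatE z) !qmulE; congr Quat; ring.
Qed.

Lemma qmulDr x y z : qmul x (y + z) = qmul x y + qmul x z.
Proof.
by rewrite (quatE x) (quatE y) (quatE z) quatD !qmulE quatD; congr Quat; ring.
Qed.

Lemma hurwitzP (x : quat) : hurwitz x <-> exists a b c d : int,
  x = Quat (a%:~R + d%:~R / 2) (b%:~R + d%:~R / 2) (c%:~R + d%:~R / 2)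
        (d%:~R / 2).
Proof.
by split=> -[a [b [c [d ->]]]]; exists a, b, c, d;
  rewrite /qt /q1 /qi /qj /qk !(quatD, quatZ); congr Quat; field.
Qed.

Lemma hurwitz0 : hurwitz 0.
Proof.
by exists 0, 0, 0, 0; rewrite !scale0r !addr0.
Qed.

Lemma hurwitzD x y : hurwitz x -> hurwitz y -> hurwitz (x + y).
Proof.
move=> /hurwitzP[a [b [c [d ->]]]] /hurwitzP[a' [b' [c' [d' ->]]]].
apply/hurwitzP; exists (a + a'), (b + b'), (c + c'), (d + d').
by rewrite quatD !intrD; congr Quat; field.
Qed.

Lemma hurwitzN x : hurwitz x -> hurwitz (- x).
Proof.
move=> [a [b [c [d ->]]]]; exists (- a), (- b), (- c), (- d).
by rewrite !intrN !scaleNr !opprD.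
Qed.

Definition translations : set (quat -> quat) :=
  [set g | exists2 l, hurwitz l & g = (fun x => x + l)].

Lemma translations_id : translations id.
Proof. by exists 0; [exact: hurwitz0|apply/funext => x; rewrite addr0]. Qed.

Lemma translations_comp g h :
  translations g -> translations h -> translations (g \o h).
Proof.
move=> [l Hl ->] [m Hm ->]; exists (m + l); first exact: hurwitzD.
by apply/funext => x /=; rewrite addrA.
Qed.

Lemma translations_inv g : translations g ->
  exists2 h, translations h & cancel g h /\ cancel h g.
Proof.
move=> [l Hl ->]; exists (fun x => x - l).
  by exists (- l) => //; exact: hurwitzN.
by split=> x; rewrite ?addrK ?subrK.
Qed.

(* A complex structure only when qmul q q = - q1. *)
Definition Hq (q : quat) : fspace R := flat_space (fun x : quat => qmul x q).

Definition lattice (q : quat) : transf_group (Hq q) :=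
  TransfGroup translations_id translations_comp translations_inv.

Definition torus (q : quat) : fspace R := orbit_space (lattice q).

(* The map (lam; r) : x |-> lam x + r; it does not depend on the chosen
   representatives when lam is in the Hurwitz order. *)
Definition aff (q : quat) (lam : quat) (r : torus q) : torus q -> torus q :=
  fun x => orbit_pi (lattice q) (qmul lam (orbit_repr x) + orbit_repr r).

(* Here -1 = (-1; 0), and -i, -j', -k' are the composites with it. *)
Definition Q8hat_set (q : quat) : set (torus q -> torus q) :=
  let o := orbit_pi (lattice q) 0 in
  let alpha := orbit_pi (lattice q) qalpha in
  let m1 := aff (- q1) o in
  let i' := aff qi o in
  let j' := aff qj alpha in
  let k' := aff qk alpha in
  [set id; m1; i'; m1 \o i'; j'; m1 \o j'; k'; m1 \o k'].

Arguments Q8hat_set q g : clear implicits.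

Section Q8hatGroup.
Variable q : quat.
Local Notation T := (torus q).
Local Notation pi := (orbit_pi (lattice q)).

Lemma torus_piP (x y : quat) : hurwitz (y - x) -> pi x = pi y.
Proof.
move=> H; apply/orbit_piP; exists (fun z => z + (y - x)); first by exists (y - x).
by rewrite addrC subrK.
Qed.

Lemma orbit_repr_pi (x : quat) :
  exists2 l, hurwitz l & orbit_repr (pi x) = x + l.
Proof.
have /orbit_piP[g [l Hl ->] <-] : pi x = pi (orbit_repr (pi x)).
  by rewrite orbit_reprK.
by exists l.
Qed.

Lemma affE (lam r x : quat) : (forall l, hurwitz l -> hurwitz (qmul lam l)) ->
  aff lam (pi r) (pi x) = pi (qmul lam x + r).
Proof.
move=> Hlam; rewrite /aff; apply: torus_piP.
have [l Hl ->] := orbit_repr_pi x; have [m Hm ->] := orbit_repr_pi r.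
rewrite qmulDr.
have -> : qmul lam x + r - (qmul lam x + qmul lam l + (r + m)) =
          - (qmul lam l + m).
  by move: (qmul lam x) (qmul lam l) => u v; apply/rowP => i; rewrite !mxE; ring.
by apply/hurwitzN/hurwitzD => //; exact: Hlam.
Qed.

Let Z4 : Type := (int * int * int * int)%type.
Let zmul (u v : Z4) : Z4 :=
  let: (a, b, c, d) := u in let: (a', b', c', d') := v in
  (a * a' - b * b' - c * c' - d * d', a * b' + b * a' + c * d' - d * c',
   a * c' - b * d' + c * a' + d * b', a * d' + b * c' - c * b' + d * a').
Let zadd (u v : Z4) : Z4 :=
  let: (a, b, c, d) := u in let: (a', b', c', d') := v in
  (a + a', b + b', c + c', d + d').
Let zsub (u v : Z4) : Z4 :=
  let: (a, b, c, d) := u in let: (a', b', c', d') := v in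
  (a - a', b - b', c - c', d - d').
Let zhur (u : Z4) : bool :=
  let: (a, b, c, d) := u in
  [&& (2 %| a - d)%Z, (2 %| b - d)%Z & (2 %| c - d)%Z].
Let Zq (u : Z4) : quat :=
  let: (a, b, c, d) := u in Quat a%:~R b%:~R c%:~R d%:~R.
Let Hf (u : Z4) : quat :=
  let: (a, b, c, d) := u in
  Quat (a%:~R / 2) (b%:~R / 2) (c%:~R / 2) (d%:~R / 2).

Let zhurP u : zhur u -> hurwitz (Hf u).
Proof.
case: u => [[[a b] c] d] /and3P[/dvdzP[a' ha] /dvdzP[b' hb] /dvdzP[c' hc]].
apply/hurwitzP; exists a', b', c', d.
have -> : a = a' * 2 + d by rewrite -ha subrK.
have -> : b = b' * 2 + d by rewrite -hb subrK.
have -> : c = c' * 2 + d by rewrite -hc subrK.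
by rewrite /Hf !intrD !intrM; congr Quat; field.
Qed.

Let Zq_hurwitz u l : hurwitz l -> hurwitz (qmul (Zq u) l).
Proof.
case: u => [[[u0 u1] u2] u3] /hurwitzP[a [b [c [d ->]]]]; apply/hurwitzP.
exists (u0 * a - u1 * (b + c + d) - u2 * (c - b) - u3 * (a + d)),
  (u0 * b + u1 * (a - c) + u2 * (b + d) - u3 * (a + c + d)),
  (u0 * c - u1 * (c + d) + u2 * (a + b + d) + u3 * (b - a)),
  (u0 * d + u1 * (c * 2 + d) - u2 * (b * 2 + d) + u3 * (a * 2 + d)).
by rewrite qmulE !(intrD, intrM, intrN); congr Quat; field.
Qed.

Let c2 (u : Z4) : Z4 :=
  if (u.1.2 != 0) || (u.2 != 0) then (1, 1, 0, 0) else (0, 0, 0, 0).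
Let us : seq Z4 :=
  [:: (1, 0, 0, 0); (-1, 0, 0, 0); (0, 1, 0, 0); (0, -1, 0, 0);
      (0, 0, 1, 0); (0, 0, -1, 0); (0, 0, 0, 1); (0, 0, 0, -1)].
Let g8 (u : Z4) : T -> T := aff (Zq u) (pi (Hf (c2 u))).

Let g8E u x : g8 u (pi x) = pi (qmul (Zq u) x + Hf (c2 u)).
Proof. by rewrite /g8 affE// => l; exact: Zq_hurwitz. Qed.

Let g8_1 : g8 (1, 0, 0, 0) = id.
Proof.
apply/funext => x; rewrite -[x]orbit_reprK g8E; congr pi.
rewrite (quatE (orbit_repr x)) /= qmulE quatD.
by congr Quat; field.
Qed.

Let defect (u v : Z4) : Z4 :=
  zsub (c2 (zmul u v)) (zadd (zmul u (c2 v)) (c2 u)).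

Let g8_comp u v : zhur (defect u v) -> g8 u \o g8 v = g8 (zmul u v).
Proof.
move=> /zhurP H; apply/funext => x; rewrite -[x]orbit_reprK /= !g8E.
apply: torus_piP; move: H; rewrite /defect.
move: (c2 (zmul u v)) (c2 u) (c2 v) (quatE (orbit_repr x)) => w cu cv ->.
case: u v w cu cv => [[[u0 u1] u2] u3] [[[v0 v1] v2] v3]
  [[[w0 w1] w2] w3] [[[a0 a1] a2] a3] [[[b0 b1] b2] b3] /=.
congr (hurwitz _).
rewrite !(qmulE, quatD, quatN) !(intrD, intrM, intrN).
by congr Quat; field.
Qed.

Let tableP : all (fun u => all (fun v =>
  (zmul u v \in us) && zhur (defect u v)) us) us.
Proof. by vm_compute. Qed.

Let invP : all (fun u => has (fun v =>
  (zmul u v == (1, 0, 0, 0)) && (zmul v u == (1, 0, 0, 0))) us) us.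
Proof. by vm_compute. Qed.

Let Q8hat_setE : Q8hat_set q = [set g | exists2 u, u \in us & g = g8 u].
Proof.
have Z1 : Hf (0, 0, 0, 0) = 0.
  by apply/rowP => -[[|[|[|[|//]]]] ?]; rewrite !mxE /= mul0r.
have Za : Hf (1, 1, 0, 0) = qalpha.
  by rewrite /qalpha /q1 /qi quatD quatZ /=; congr Quat; field.
have Zm : Zq (-1, 0, 0, 0) = - q1.
  by rewrite /q1 quatN /=; congr Quat; ring.
have M u v : u \in us -> v \in us -> g8 u \o g8 v = g8 (zmul u v).
  move=> uu vv; apply: g8_comp.
  by have /allP/(_ u uu)/allP/(_ v vv)/andP[] := tableP.
have E u : g8 u = aff (Zq u) (pi (Hf (c2 u))) by [].
pose m := (-1, 0, 0, 0) : Z4.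
have Em : aff (- q1) (pi 0) = g8 m by rewrite E -[c2 _]/((0, 0, 0, 0) : Z4) Z1 Zm.
have Ei : aff qi (pi 0) = g8 (0, 1, 0, 0) by rewrite E -[c2 _]/((0, 0, 0, 0) : Z4) Z1.
have Ej : aff qj (pi qalpha) = g8 (0, 0, 1, 0) by rewrite E -[c2 _]/((1, 1, 0, 0) : Z4) Za.
have Ek : aff qk (pi qalpha) = g8 (0, 0, 0, 1) by rewrite E -[c2 _]/((1, 1, 0, 0) : Z4) Za.
rewrite /Q8hat_set Em Ei Ej Ek !M //= -g8_1.
apply/seteqP; split=> [g /=|g [u]].
  by case=> [[[[[[[->|->]|->]|->]|->]|->]|->]|->]; (eexists; [|reflexivity]).
rewrite !inE; move=> + ->; rewrite /=.
do 7?[case/orP=> [/eqP->|]]; last move/eqP->; rewrite /=; tauto.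
Qed.

Lemma Q8hat_id : Q8hat_set q id.
Proof. by rewrite Q8hat_setE; exists (1, 0, 0, 0). Qed.

Lemma Q8hat_comp g h :
  Q8hat_set q g -> Q8hat_set q h -> Q8hat_set q (g \o h).
Proof.
rewrite Q8hat_setE => -[u uu ->] [v vv ->].
have /allP/(_ u uu)/allP/(_ v vv)/andP[uv d] := tableP.
by exists (zmul u v) => //; exact: g8_comp.
Qed.

Lemma Q8hat_inv g : Q8hat_set q g ->
  exists2 h, Q8hat_set q h & cancel g h /\ cancel h g.
Proof.
rewrite Q8hat_setE => -[u uu ->].
have /allP/(_ u uu)/hasP[v vv /andP[/eqP uv /eqP vu]] := invP.
have /allP/(_ u uu)/allP/(_ v vv)/andP[_ duv] := tableP.
have /allP/(_ v vv)/allP/(_ u uu)/andP[_ dvu] := tableP.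
exists (g8 v); first by exists v.
by split=> x; rewrite -[LHS]/((_ \o _) x) g8_comp// ?uv ?vu g8_1.
Qed.

Definition Q8hat : transf_group (torus q) :=
  TransfGroup Q8hat_id Q8hat_comp Q8hat_inv.

End Q8hatGroup.

End Quaternions.

(* Main.v *)
From HB Require Import structures.
Require Import Defs.
From mathcomp Require Import all_boot all_order all_algebra.
From mathcomp Require Import all_classical all_reals all_analysis.
From mathcomp Require Import complex ring lra.

(** The quotient of the torus by the group is H/Γ, where Γ is generated by the
translations of the Hurwitz lattice Λ and by the affine lifts
x |-> u x + c of the eight automorphisms, u = ±1, ±i, ±j, ±k.  So H -> H/Γ is
the quotient by a group that acts properly discontinuously, and the germ of
H/Γ at the image of x is the quotient of H by the stabilizer of x, which acts
linearly, through left multiplication by the units u ([local_model]).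

Left multiplication by a unit v with v^2 = -1 commutes with right
multiplication by q.  As any two square roots of -1 are conjugate
([pure_units_conj]), there are e1 and e2 with v e1 = e1 q and v e2 = - e2 q;
they are a basis of H over R[q] = C in which v becomes diag(i, -i), whatever q
is.  Hence a stabilizer with units {1}, {±1} or {±1, ±v} gives a smooth point,
an A_1 point or an A_3 point.

It remains to count.  A nontrivial stabilizer contains an element with unit
-1, since u^2 = -1 for the other units, and this forces 2 x into Λ.  The 16
classes of such x modulo Λ form seven orbits: one has the stabilizer {±1}, and
six have a stabilizer {±1, ±v} with v = i, j or k.  These are finite
computations with integers, done by evaluation.

That A_1 and A_3 points are singular is shown for every C^2/mu_N with N even
([cyclic_singular]).  An isomorphism with the germ of C^2 at 0 lifts to a
holomorphic map Φ from a neighbourhood of 0 to C^2, through which the three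
invariants x y, x^N, y^N factor holomorphically: P_i = F_i o Φ.  Three
differentials of F_i at 0 in a space of dimension two are dependent, so a
nontrivial combination F of the F_i has F(v) = o(|v|).  On the axes Φ depends
only on the N-th power of the parameter, so that Φ = O(|z|^N) there and
F o Φ = o(|z|^N): the coefficients of x^N and y^N vanish.  On the diagonal Φ is
even, hence Φ = O(|z|^2), and the coefficient of x y vanishes as well.

The growth estimate ([invariant_bound]) bounds a removable quotient by its
values on a circle.  This needs the maximum principle, which is derived from
the mean value inequality, that is, from the theorem of Goursat for rectangles
transported by the exponential. *)

Set Implicit Arguments.
Unset Strict Implicit.
Unset Printing Implicit Defensive.

Import Order.TTheory GRing.Theory Num.Theory.
Import numFieldNormedType.Exports.

Local Open Scope classical_set_scope.
Local Open Scope ring_scope.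

(** * Complex numbers as a real normed space *)

Section ComplexAlgebra.
Variable R : realType.
Local Notation C := (Rcomplex R).
Implicit Types z w : C.
Local Notation cmod z := (`|(z : Rcomplex R)|).

Lemma cnormM z w : cmod (z * w) = `|z| * `|w|.
Proof. exact: Normc.normcM. Qed.

Lemma cnormV z : cmod (z^-1) = `|z|^-1.
Proof. exact: Normc.normcV. Qed.

Lemma cnorm1 : `|1 : C| = 1.
Proof. exact: Normc.normc1. Qed.

Lemma cnormX z n : cmod (z ^+ n) = `|z| ^+ n.
Proof. by elim: n => [|n IH]; rewrite ?expr0 ?cnorm1// !exprS cnormM IH. Qed.

Lemma cnormi : `|'i%C : C| = 1.
Proof. by rewrite /Num.norm /= /Normc.normc /= expr0n expr1n add0r sqrtr1. Qed.

Lemma cnormE z : `|z| = Num.sqrt (complex.Re z ^+ 2 + complex.Im z ^+ 2).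
Proof. by case: z. Qed.

Lemma cnorm_Re z : `|complex.Re z| <= `|z|.
Proof.
rewrite cnormE -sqrtr_sqr ler_wsqrtr// lerDl sqr_ge0//.
Qed.

Lemma cnorm_Im z : `|complex.Im z| <= `|z|.
Proof.
rewrite cnormE -sqrtr_sqr ler_wsqrtr// lerDr sqr_ge0//.
Qed.

Lemma cnorm_le z : `|z| <= `|complex.Re z| + `|complex.Im z|.
Proof.
rewrite cnormE -[leRHS]ger0_norm ?addr_ge0// -sqrtr_sqr ler_wsqrtr//.
rewrite sqrrD !real_normK ?num_real// lerD2r lerDl.
by rewrite mulrn_wge0// mulr_ge0.
Qed.

Lemma cnormi_mul z : cmod (('i%C : C) * z) = `|z|.
Proof. by rewrite cnormM cnormi mul1r. Qed.

(** The real bilinear form of the product: its continuity is that of scaling. *)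
Lemma cmulE z w : z * w = complex.Re z *: w + complex.Im z *: (('i%C : C) * w).
Proof.
case: z w => [a b] [c d]; rewrite /GRing.scale /=; apply/eqP; rewrite eq_complex /=; simpc.
by [].
Qed.

Lemma lipschitz_cont (V W : normedModType R) (f : V -> W) (k : R) :
  (forall x y, `|f x - f y| <= k * `|x - y|) -> continuous f.
Proof.
move=> fk x; apply/cvgrPdist_le => e e0; near=> y.
rewrite (le_trans (fk _ _))// (@le_trans _ _ ((`|k| + 1) * `|x - y|))//.
  by rewrite ler_wpM2r// (le_trans (ler_norm _))// lerDl.
rewrite mulrC -ler_pdivlMr ?ltr_pwDr//.
near: y; apply: cvgr_dist_le => //; rewrite divr_gt0// ltr_pwDr//.
Unshelve. all: by end_near. Qed.

Lemma Re_continuous : continuous (@complex.Re R : C -> R).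
Proof.
by apply: (@lipschitz_cont _ _ _ 1) => z w; rewrite mul1r -raddfB cnorm_Re.
Qed.

Lemma Im_continuous : continuous (@complex.Im R : C -> R).
Proof.
by apply: (@lipschitz_cont _ _ _ 1) => z w; rewrite mul1r -raddfB cnorm_Im.
Qed.

Lemma imul_continuous : continuous ((fun z => ('i%C : C) * z) : C -> C).
Proof.
by apply: (@lipschitz_cont _ _ _ 1) => z w; rewrite -mulrBr mul1r cnormi_mul.
Qed.

Section Cvg.
Context {T : Type} {F : set_system T} {FF : Filter F}.

Lemma ccvgM (f g : T -> C) (a b : C) :
  f @ F --> a -> g @ F --> b -> (fun x => f x * g x : C) @ F --> (a * b : C).
Proof.
move=> fa gb; rewrite cmulE.
rewrite (_ : (fun x => _) = fun x => complex.Re (f x) *: g x +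
  complex.Im (f x) *: (('i%C : C) * g x)); last by apply/funext => x; rewrite cmulE.
apply: cvgD; apply: cvgZ => //.
apply: continuous_cvg fa; exact: Re_continuous.
apply: continuous_cvg fa; exact: Im_continuous.
apply: continuous_cvg gb; exact: imul_continuous.
Qed.

Lemma ccvgV (f : T -> C) (a : C) : a != 0 -> f @ F --> a ->
  (fun x => (f x)^-1 : C) @ F --> (a^-1 : C).
Proof.
move=> a0 fa.
have E z : z^-1 = `|z| ^- 2 *: (complex.Re z *: 1 - complex.Im z *: ('i%C : C)).
  case: z => x y; rewrite cnormE sqr_sqrtr ?addr_ge0 ?sqr_ge0// /GRing.scale /=.
  apply/eqP; rewrite eq_complex /=; simpc; rewrite /=.
  by rewrite !(mulrC (_^-1)) !eqxx.
rewrite E (_ : (fun x => _) = fun x => `|f x| ^- 2 *: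
  (complex.Re (f x) *: 1 - complex.Im (f x) *: ('i%C : C))); last first.
  by apply/funext => x; rewrite E.
apply: cvgZ.
  apply: cvgV; first by rewrite expf_neq0// normr_eq0.
  rewrite expr2 (_ : (fun x => _) = fun x => `|f x| * `|f x|); last exact/funext.
  by apply: cvgM; exact: cvg_norm.
apply: cvgB; apply: cvgZr_tmp.
  apply: continuous_cvg fa; exact: Re_continuous.
apply: continuous_cvg fa; exact: Im_continuous.
Qed.
End Cvg.

(** * Complex differentiability in one variable *)

Definition ccont (f : C -> C) (x : C) := {for x, continuous f}.

Lemma ccont_cst (c x : C) : ccont (fun _ => c) x.
Proof. exact: (@cvg_cst C c C (nbhs x)). Qed.

Lemma ccont_id (x : C) : ccont id x.
Proof. by move=> P. Qed.

Lemma ccontP (f : C -> C) (x : C) : ccont f x <->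
  forall e : R, 0 < e -> \forall y \near x, cmod (f x - f y) <= e.
Proof. exact: (@cvgrPdist_le R C C (nbhs x) _ f (f x)). Qed.

Lemma near_cP (x : C) (P : set C) : (\forall y \near x, P y) <->
  exists2 d : R, 0 < d & forall y, cmod (y - x) < d -> P y.
Proof.
split=> [/(@nbhs_normP R C)[d /= d0 H]|[d d0 H]].
  by exists d => // y yx; apply: H; rewrite /= distrC.
by apply/(@nbhs_normP R C); exists d => // y /=; rewrite distrC; exact: H.
Qed.

Lemma ccont_eq_near (f g : C -> C) (x : C) :
  (\forall y \near x, f y = g y) -> ccont f x -> ccont g x.
Proof.
move=> fg /ccontP cf; have E : f x = g x by exact: nbhs_singleton fg.
apply/ccontP => e /cf cfe; near=> y.
by rewrite -E -(near fg y)// (near cfe y).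
Unshelve. all: by end_near. Qed.

Lemma ccontD (f g : C -> C) (x : C) : ccont f x -> ccont g x ->
  ccont (fun y => f y + g y) x.
Proof. exact: (@cvgD R C C (nbhs x) _ f g (f x) (g x)). Qed.

Lemma ccontM (f g : C -> C) (x : C) : ccont f x -> ccont g x ->
  ccont (fun y => f y * g y) x.
Proof. exact: (@ccvgM C (nbhs x) _ f g (f x) (g x)). Qed.

Lemma ccontV (f : C -> C) (x : C) : f x != 0 -> ccont f x ->
  ccont (fun y => (f y)^-1) x.
Proof. exact: (@ccvgV C (nbhs x) _ f (f x)). Qed.

Lemma ccontN (f : C -> C) (x : C) : ccont f x -> ccont (fun y => - f y) x.
Proof. exact: (@cvgN R C C (nbhs x) _ f (f x)). Qed.

Lemma ccont_comp (f g : C -> C) (x : C) : ccont g x -> ccont f (g x) ->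
  ccont (fun y => f (g y)) x.
Proof. exact: (@continuous_comp C C C g f x). Qed.

(** Differentiability in the form of Caratheodory: the difference quotient
extends continuously to x.  Products and composites then need no estimates. *)
Definition cdiff (f : C -> C) (x : C) := exists2 phi : C -> C,
  ccont phi x & forall y, f y = f x + phi y * (y - x).

(** Away from x the function phi may be replaced by the difference quotient, so
a relation near x is enough. *)
Lemma cdiff_near (f phi : C -> C) (x : C) : ccont phi x ->
  (\forall y \near x, f y = f x + phi y * (y - x)) -> cdiff f x.
Proof.
move=> cphi fphi.
exists (fun y => if y == x then phi x else (f y - f x) / (y - x)); last first.
  move=> y; case: eqP => [->|/eqP yx]; first by rewrite subrr mulr0 addr0.
  by rewrite divfK ?subr_eq0// addrC subrK.
apply: ccont_eq_near cphi; near=> y; case: eqP => [->//|/eqP yx].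
rewrite [f y](near fphi y)//.
by rewrite (addrC (f x)) addrK mulfK// subr_eq0.
Unshelve. all: by end_near. Qed.

Lemma cdiff_eq_near (f g : C -> C) (x : C) :
  (\forall y \near x, f y = g y) -> cdiff f x -> cdiff g x.
Proof.
move=> fg [phi cphi fphi]; apply: (cdiff_near cphi).
have E : f x = g x by exact: nbhs_singleton fg.
near=> y; rewrite -E -fphi; apply/esym.
exact: (near fg y).
Unshelve. all: by end_near. Qed.

Lemma cdiff_cont (f : C -> C) (x : C) : cdiff f x -> ccont f x.
Proof.
move=> [phi cphi fphi].
rewrite (_ : f = fun y => f x + phi y * (y - x)); last exact/funext.
apply: ccontD; first exact: ccont_cst.
apply: ccontM => //; apply: ccontD; [exact: ccont_id|exact: ccont_cst].
Qed.

Lemma cdiff_cst (c x : C) : cdiff (fun _ => c) x.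
Proof.
exists (fun _ => 0); first exact: ccont_cst.
by move=> y; rewrite mul0r addr0.
Qed.

Lemma cdiff_id (x : C) : cdiff id x.
Proof.
exists (fun _ => 1); first exact: ccont_cst.
by move=> y; rewrite mul1r addrC subrK.
Qed.

Lemma cdiffD (f g : C -> C) (x : C) : cdiff f x -> cdiff g x ->
  cdiff (fun y => f y + g y) x.
Proof.
move=> [p cp fp] [q cq gq]; exists (fun y => p y + q y); first exact: ccontD.
by move=> y; rewrite fp gq; ring.
Qed.

Lemma cdiffM (f g : C -> C) (x : C) : cdiff f x -> cdiff g x ->
  cdiff (fun y => f y * g y) x.
Proof.
move=> df dg; have [p cp fp] := df; have [q cq gq] := dg.
exists (fun y => p y * g y + f x * q y); last first.
  move=> y; have -> : f y = f x + p y * (y - x) by [].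
  by rewrite mulrDl {1}gq; ring.
apply: ccontD; apply: ccontM => //; [exact: cdiff_cont|exact: ccont_cst].
Qed.

Lemma cdiffN (f : C -> C) (x : C) : cdiff f x -> cdiff (fun y => - f y) x.
Proof.
move=> df; have := cdiffM (cdiff_cst (-1) x) df.
by under eq_fun do rewrite mulN1r.
Qed.

Lemma cdiffB (f g : C -> C) (x : C) : cdiff f x -> cdiff g x ->
  cdiff (fun y => f y - g y) x.
Proof. by move=> df dg; apply: cdiffD => //; exact: cdiffN. Qed.

Lemma cdiffX (f : C -> C) n (x : C) : cdiff f x -> cdiff (fun y => f y ^+ n) x.
Proof.
move=> df; elim: n => [|n IH]; first exact: cdiff_cst.
by under eq_fun do rewrite exprS; exact: cdiffM.
Qed.

Lemma near_neq0 (f : C -> C) (x : C) : ccont f x -> f x != 0 ->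
  \forall y \near x, f y != 0.
Proof.
move=> /ccontP cf fx0; have /cf : 0 < cmod (f x) / 2.
  by rewrite divr_gt0// normr_gt0.
apply: (@filterS _ (nbhs x)) => y; apply: contraTneq => ->.
by rewrite subr0 -ltNge gtr_pMr ?invf_lt1 ?ltr1n// normr_gt0.
Qed.

Lemma cdiffV (f : C -> C) (x : C) : cdiff f x -> f x != 0 ->
  cdiff (fun y => (f y)^-1) x.
Proof.
move=> df fx0; have [p cp fp] := df; have cf := cdiff_cont df.
apply: (@cdiff_near _ (fun y => - p y / (f y * f x))).
  apply: ccontM; first exact: ccontN.
  by apply: ccontV; [rewrite mulf_neq0|apply: ccontM => //; exact: ccont_cst].
have fn0 := near_neq0 cf fx0.
near=> y; have fy0 : f y != 0 by exact: (near fn0 y).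
have E : p y * (y - x) = f y - f x by rewrite [f y]fp; ring.
have -> : - p y / (f y * f x) * (y - x) = - (p y * (y - x)) / (f y * f x).
  by rewrite !mulNr mulrAC.
by rewrite E; field; rewrite fy0 fx0.
Unshelve. all: by end_near. Qed.

Lemma cdiff_comp (f g : C -> C) (x : C) : cdiff g x -> cdiff f (g x) ->
  cdiff (fun y => f (g y)) x.
Proof.
move=> dg; have [q cq gq] := dg => -[p cp fp].
exists (fun y => p (g y) * q y); last first.
  by move=> y /=; rewrite fp; congr (_ + _); rewrite {2}gq; ring.
by apply: ccontM => //; apply: ccont_comp => //; exact: cdiff_cont.
Qed.

Lemma cdiff_err (f : C -> C) (x : C) : cdiff f x -> exists w : C,
  forall e : R, 0 < e -> \forall y \near x,
    cmod (f y - f x - w * (y - x)) <= e * cmod (y - x).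
Proof.
move=> [p /ccontP cp fp]; exists (p x) => e /cp.
apply: (@filterS _ (nbhs x)) => y H.
rewrite {1}fp (_ : _ - _ - _ = (p y - p x) * (y - x)); last by ring.
by rewrite cnormM ler_wpM2r// distrC.
Qed.

End ComplexAlgebra.

(** * Integrals over a segment *)

Section SegmentIntegral.
Variable R : realType.
Local Notation mu := (@lebesgue_measure R).

Definition rint (f : R -> R) (a b : R) : R := \int[mu]_(x in `[a, b]) f x.

Definition cont_on (f : R -> R) (a b : R) :=
  forall x, a <= x <= b -> {for x, continuous f}.

Lemma cont_on_integrable f a b : cont_on f a b ->
  mu.-integrable `[a, b] (EFin \o f).
Proof.
move=> cf; apply: continuous_compact_integrable; first exact: segment_compact.
apply: continuous_in_subspaceT => x; rewrite inE /= in_itv /= => xab.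
exact: cf.
Qed.

Lemma rint_split f a c b : a <= c -> c <= b -> cont_on f a b ->
  rint f a b = rint f a c + rint f c b.
Proof.
move=> ac cb cf; have fi := cont_on_integrable cf.
have := @Rintegral_itvB R f (BLeft a) (BRight b) c fi.
rewrite !bnd_simp => /(_ ac cb) E; rewrite /rint.
rewrite -(@Rintegral_itv_obnd_cbnd R c (BRight b)); last first.
  apply: integrableS fi => //.
  by apply: subset_itvScc; rewrite ?bnd_simp.
by rewrite -E addrC subrK.
Qed.

Lemma rint_cst (k a b : R) : a <= b -> rint (fun _ => k) a b = k * (b - a).
Proof.
move=> ab; rewrite /rint Rintegral_cst//= lebesgue_measure_itv /= lte_fin.
case: (ltrgtP a b) ab => //= -> _.
by rewrite subrr.
Qed.

Lemma rint_le f g a b : cont_on f a b -> cont_on g a b ->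
  (forall x, a <= x <= b -> f x <= g x) -> rint f a b <= rint g a b.
Proof.
move=> cf cg fg; apply: le_Rintegral => //; try exact: cont_on_integrable.
Qed.

Lemma cont_on_cst k a b : cont_on (fun _ => k) a b.
Proof. by move=> x _; exact: cvg_cst. Qed.

Lemma rintB f g a b : cont_on f a b -> cont_on g a b ->
  rint (fun x => f x - g x) a b = rint f a b - rint g a b.
Proof. by move=> cf cg; apply: RintegralB => //; exact: cont_on_integrable. Qed.

Lemma rint_near_cst f k e a b : a <= b -> cont_on f a b ->
  (forall x, a <= x <= b -> `|f x - k| <= e) ->
  `|rint f a b - k * (b - a)| <= e * (b - a).
Proof.
move=> ab cf H; rewrite ler_norml; apply/andP; split.
  have : rint (fun _ => k - e) a b <= rint f a b.
    apply: rint_le => //; first exact: cont_on_cst.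
    by move=> x /H; rewrite ler_norml => /andP[]; lra.
  by rewrite rint_cst//; lra.
have : rint f a b <= rint (fun _ => k + e) a b.
  apply: rint_le => //; first exact: cont_on_cst.
  by move=> x /H; rewrite ler_norml => /andP[]; lra.
by rewrite rint_cst//; lra.
Qed.

End SegmentIntegral.

#[local] Opaque rint.

(** * The theorem of Goursat for rectangles *)

Section Goursat.
Variable R : realType.
Local Notation C := (Rcomplex R).
Local Notation cmod z := (`|(z : Rcomplex R)|).

Definition cpt (s t : R) : C := (s +i* t)%C.

(** The imaginary part of the integral of f along the boundary of
[a, b] x [c, d], counterclockwise: Re f comes from the vertical sides and Im f
from the horizontal ones. *)
Definition contour_im (f : C -> C) (a b c d : R) : R :=
  (rint (fun t => complex.Re (f (cpt b t))) c d -
   rint (fun t => complex.Re (f (cpt a t))) c d) +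
  (rint (fun s => complex.Im (f (cpt s c))) a b -
   rint (fun s => complex.Im (f (cpt s d))) a b).

Definition in_rect (a b c d s t : R) := (a <= s <= b) && (c <= t <= d).

Lemma cpt_norm s t : cmod (cpt s t) <= `|s| + `|t|.
Proof. exact: cnorm_le. Qed.

Lemma cpt_contl t : continuous ((fun s => cpt s t) : R -> C).
Proof.
apply: (@lipschitz_cont R _ _ _ 1) => x y; rewrite mul1r.
have -> : cpt x t - cpt y t = cpt (x - y) 0 by rewrite /cpt; simpc.
by rewrite (le_trans (cpt_norm _ _))// normr0 addr0.
Qed.

Lemma cpt_contr s : continuous ((fun t => cpt s t) : R -> C).
Proof.
apply: (@lipschitz_cont R _ _ _ 1) => x y; rewrite mul1r.
have -> : cpt s x - cpt s y = cpt 0 (x - y) by rewrite /cpt; simpc.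
by rewrite (le_trans (cpt_norm _ _))// normr0 add0r.
Qed.

Section Rect.
Variables (f : C -> C) (a b c d : R).
Hypothesis cf : forall s t, in_rect a b c d s t -> ccont f (cpt s t).

Lemma cont_Re_vert s : a <= s <= b ->
  cont_on (fun t => complex.Re (f (cpt s t))) c d.
Proof.
move=> sab t tcd; apply: (@continuous_comp R C R (fun t => f (cpt s t))).
  apply: (@continuous_comp R C C); first exact: cpt_contr.
  by apply: cf; rewrite /in_rect sab tcd.
exact: Re_continuous.
Qed.

Lemma cont_Im_hor t : c <= t <= d ->
  cont_on (fun s => complex.Im (f (cpt s t))) a b.
Proof.
move=> tcd s sab; apply: (@continuous_comp R C R (fun s => f (cpt s t))).
  apply: (@continuous_comp R C C (fun s => cpt s t)); first exact: cpt_contl.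
  by apply: cf; rewrite /in_rect sab tcd.
exact: Im_continuous.
Qed.

Lemma contour_im_hsplit m : a <= m <= b -> c <= d ->
  contour_im f a b c d = contour_im f a m c d + contour_im f m b c d.
Proof.
move=> /andP[am mb] cd; rewrite /contour_im.
rewrite (rint_split am mb (cont_Im_hor _)) ?lexx ?cd//.
rewrite (rint_split am mb (cont_Im_hor _)) ?lexx ?cd//.
ring.
Qed.

Lemma contour_im_vsplit m : c <= m <= d -> a <= b ->
  contour_im f a b c d = contour_im f a b c m + contour_im f a b m d.
Proof.
move=> /andP[cm md] ab; rewrite /contour_im.
rewrite (rint_split cm md (cont_Re_vert _)) ?lexx ?ab//.
rewrite (rint_split cm md (cont_Re_vert _)) ?lexx ?ab//.
ring.
Qed.

(** An affine function takes values differing by a constant on two opposite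
sides, and the contributions of the two pairs of sides cancel.  Only the
distance from f to the affine function is left. *)
Lemma contour_im_small (f0 w z0 : C) (e : R) : a <= b -> c <= d ->
  (forall s t, in_rect a b c d s t ->
     cmod (f (cpt s t) - f0 - w * (cpt s t - z0)) <= e) ->
  `|contour_im f a b c d| <= 2 * e * ((b - a) + (d - c)).
Proof.
move=> ab cd H.
have D s t s' t' : in_rect a b c d s t -> in_rect a b c d s' t' ->
    cmod (f (cpt s t) - f (cpt s' t') - w * (cpt s t - cpt s' t')) <= 2 * e.
  move=> /H h1 /H h2.
  rewrite (_ : _ - _ = (f (cpt s t) - f0 - w * (cpt s t - z0)) -
    (f (cpt s' t') - f0 - w * (cpt s' t' - z0))); last by ring.
  by rewrite (le_trans (ler_normB _ _))//; lra.
rewrite /contour_im -!rintB; try (by apply: cont_Re_vert; rewrite ?lexx ?ab);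
  try (by apply: cont_Im_hor; rewrite ?lexx ?cd).
set I1 := rint _ _ _; set I2 := rint _ _ _.
have B1 : `|I1 - complex.Re w * (b - a) * (d - c)| <= 2 * e * (d - c).
  apply: rint_near_cst => // [t tcd|t tcd].
    apply: cvgB; [apply: cont_Re_vert tcd|apply: cont_Re_vert tcd];
      by rewrite ?lexx ?ab.
  have := D b t a t; rewrite /in_rect !lexx ab tcd => /(_ isT isT).
  apply: le_trans; apply: le_trans (cnorm_Re _).
  rewrite /cpt; case: (f _) => u v; case: (f _) => u' v'; case: (w) => w1 w2 /=.
  by rewrite subrr mulr0 subr0.
have B2 : `|I2 - - complex.Re w * (d - c) * (b - a)| <= 2 * e * (b - a).
  apply: rint_near_cst => // [s sab|s sab].
    apply: cvgB; [apply: cont_Im_hor sab|apply: cont_Im_hor sab];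
      by rewrite ?lexx ?cd.
  have := D s c s d; rewrite /in_rect !lexx cd sab => /(_ isT isT).
  apply: le_trans; apply: le_trans (cnorm_Im _).
  rewrite /cpt; case: (f _) => u v; case: (f _) => u' v'; case: (w) => w1 w2 /=.
  rewrite subrr mulr0 addr0 (_ : w1 * (c - d) = - w1 * (d - c))//; by ring.
rewrite (_ : I1 + I2 = (I1 - complex.Re w * (b - a) * (d - c)) +
  (I2 - - complex.Re w * (d - c) * (b - a))); last by ring.
rewrite (le_trans (ler_normD _ _))//; lra.
Qed.

End Rect.

(** Bisection.  One quarter of a rectangle carries at least a quarter of the
integral.  Iterating, one obtains rectangles of size S / 2^n that shrink to a
point, with integral at least 4^-n times the initial one.  Near this point f is
affine up to an error small compared with the distance, so the integral is
small compared with (S / 2^n)^2. *)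
Lemma goursat (f : C -> C) (a b c d : R) : a <= b -> c <= d ->
  (forall s t, in_rect a b c d s t -> cdiff f (cpt s t)) -> contour_im f a b c d = 0.
Proof.
move=> ab cd df.
have cf s t : in_rect a b c d s t -> ccont f (cpt s t) by move=> /df/cdiff_cont.
pose l n : R := (b - a) / 2 ^+ n; pose h n : R := (d - c) / 2 ^+ n.
have l0 n : 0 <= l n by rewrite /l divr_ge0 ?subr_ge0 ?exprn_ge0.
have h0 n : 0 <= h n by rewrite /h divr_ge0 ?subr_ge0 ?exprn_ge0.
have lS n : l n = l n.+1 + l n.+1.
  by rewrite /l exprS; field; rewrite expf_neq0.
have hS n : h n = h n.+1 + h n.+1.
  by rewrite /h exprS; field; rewrite expf_neq0.
pose K n (p : R * R) := contour_im f p.1 (p.1 + l n) p.2 (p.2 + h n).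
pose good n (p : R * R) := [/\ a <= p.1, p.1 + l n <= b, c <= p.2 & p.2 + h n <= d].
pose next n (p p' : R * R) := [/\ good n.+1 p', p.1 <= p'.1, p'.1 + l n.+1 <= p.1 + l n,
  p.2 <= p'.2 & p'.2 + h n.+1 <= p.2 + h n] /\ `|K n p| <= 4 * `|K n.+1 p'|.
have step n p : good n p -> exists p', next n p p'.
  case: p => x y [/= ax xb cy yd].
  have cfs a' b' c' d' : a <= a' -> b' <= b -> c <= c' -> d' <= d ->
      forall s t, in_rect a' b' c' d' s t -> ccont f (cpt s t).
    move=> ha hb hc hd s t /andP[/andP[h1 h2] /andP[h3 h4]]; apply: cf.
    by rewrite /in_rect (le_trans ha h1) (le_trans h2 hb) (le_trans hc h3) (le_trans h4 hd).
  have := l0 n.+1; have := h0 n.+1; have := lS n; have := hS n.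
  set l' := l n.+1; set h' := h n.+1 => hn ln hp lp.
  have E : K n (x, y) = K n.+1 (x, y) + K n.+1 (x, y + h')
             + (K n.+1 (x + l', y) + K n.+1 (x + l', y + h')).
    rewrite /K /= -/l' -/h' ln hn !(addrA x) !(addrA y).
    rewrite (@contour_im_hsplit f x (x + l' + l') y (y + h' + h') _ (x + l')); last 3 first.
    - by apply: cfs; lra.
    - by apply/andP; split; lra.
    - by lra.
    rewrite (@contour_im_vsplit f x (x + l') y (y + h' + h') _ (y + h')); last 3 first.
    - by apply: cfs; lra.
    - by apply/andP; split; lra.
    - by lra.
    rewrite (@contour_im_vsplit f (x + l') (x + l' + l') y (y + h' + h') _ (y + h')); last 3 first.
    - by apply: cfs; lra.
    - by apply/andP; split; lra.
    - by lra.
    by [].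
  apply: contrapT => N.
  have B u v : (u = x \/ u = x + l') -> (v = y \/ v = y + h') ->
      4 * `|K n.+1 (u, v)| < `|K n (x, y)|.
    move=> hu hv; rewrite ltNge; apply/negP => hK; apply: N; exists (u, v).
        have [u1 u2] : x <= u /\ u + l' <= x + (l' + l') by case: hu => ->; lra.
    have [v1 v2] : y <= v /\ v + h' <= y + (h' + h') by case: hv => ->; lra.
    by split=> //; split; rewrite /good /= -?/l' -?/h' ?ln ?hn; try split => /=; lra.
  have B1 := B x y (or_introl erefl) (or_introl erefl).
  have B2 := B x (y + h') (or_introl erefl) (or_intror erefl).
  have B3 := B (x + l') y (or_intror erefl) (or_introl erefl).
  have B4 := B (x + l') (y + h') (or_intror erefl) (or_intror erefl).
  have := ler_normD (K n.+1 (x, y) + K n.+1 (x, y + h'))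
             (K n.+1 (x + l', y) + K n.+1 (x + l', y + h')).
  have := ler_normD (K n.+1 (x, y)) (K n.+1 (x, y + h')).
  have := ler_normD (K n.+1 (x + l', y)) (K n.+1 (x + l', y + h')).
  rewrite -E; lra.
have /choice[g gP] : forall np : nat * (R * R), exists p',
    good np.1 np.2 -> next np.1 np.2 p'.
  move=> [n p] /=.
  have [/step[p' H]|N] := pselect (good n p); first by exists p'.
  by exists p => /N.
pose z := fix z n := if n is m.+1 then g (m, z m) else (a, c).
have zgood n : good n (z n).
  elim: n => [|n IH].
    by rewrite /good /= /l /h expr0 !divr1 !lexx !(addrC _ (_ - _)) !subrK.
  by have [[]] := gP (n, z n) IH.
have znext n : next n (z n) (z n.+1) by exact: (gP (n, z n) (zgood n)).
(* The rectangles are nested, so the suprema of the left and lower ends lie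
   in all of them. *)
have zmono n k : [/\ (z n).1 <= (z (k + n)%N).1, (z (k + n)%N).1 + l (k + n)%N <= (z n).1 + l n,
   (z n).2 <= (z (k + n)%N).2 & (z (k + n)%N).2 + h (k + n)%N <= (z n).2 + h n].
  elim: k => [|k [h1 h2 h3 h4]]; first by rewrite add0n !lexx.
  have [[_ k1 k2 k3 k4] _] := znext (k + n)%N.
  by rewrite addSn; split; [exact: le_trans k1|exact: (le_trans k2)|exact: le_trans k3|exact: (le_trans k4)].
pose x0 := sup (range (fun n => (z n).1)); pose y0 := sup (range (fun n => (z n).2)).
have xy n m : (z n).1 <= (z m).1 + l m /\ (z n).2 <= (z m).2 + h m.
  have [h1 _ h3 _] := zmono n m; have [_ k2 _ k4] := zmono m n.
  have := l0 (n + m)%N; have := h0 (n + m)%N; rewrite addnC in h1 h3.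
  by move=> ? ?; split; lra.
have xin n : (z n).1 <= x0 <= (z n).1 + l n.
  apply/andP; split.
    apply: ub_le_sup; last by exists n.
    by exists ((z 0%N).1 + l 0%N) => _ [m _ <-]; exact: (xy m 0%N).1.
  by apply: ge_sup; [exists (z 0%N).1; exists 0%N|move=> _ [m _ <-]; exact: (xy m n).1].
have yin n : (z n).2 <= y0 <= (z n).2 + h n.
  apply/andP; split.
    apply: ub_le_sup; last by exists n.
    by exists ((z 0%N).2 + h 0%N) => _ [m _ <-]; exact: (xy m 0%N).2.
  by apply: ge_sup; [exists (z 0%N).2; exists 0%N|move=> _ [m _ <-]; exact: (xy m n).2].
have Kn n : `|contour_im f a b c d| <= 4 ^+ n * `|K n (z n)|.
  elim: n => [|n IH].
    rewrite expr0 mul1r /K /= /l /h expr0 !divr1.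
    by rewrite !(addrC _ (_ - _)) !subrK.
  by rewrite (le_trans IH)// exprSr -mulrA ler_wpM2l ?exprn_ge0//; case: (znext n).
have [w wP] : exists w : C, forall e : R, 0 < e -> \forall y \near cpt x0 y0,
    cmod (f y - f (cpt x0 y0) - w * (y - cpt x0 y0)) <= e * cmod (y - cpt x0 y0).
  apply/cdiff_err/df; have [g1 g2 g3 g4] := zgood 0%N.
  have /andP[u1 u2] := xin 0%N; have /andP[v1 v2] := yin 0%N.
  by rewrite /in_rect; apply/andP; split; apply/andP; split; lra.
pose S := (b - a) + (d - c).
have S0 : 0 <= S by rewrite /S; lra.
apply/eqP; rewrite -normr_le0; apply/ler_addgt0Pr => e e0; rewrite add0r.
(* The precision is chosen so that 2 S^2 times it is less than e. *)
have e1 : 0 < e / (2 * S ^+ 2 + 1) by rewrite divr_gt0// ltr_wpDl// mulr_ge0// sqr_ge0.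
have /near_cP[r r0 rP] := wP _ e1.
have [n nP] : exists n, S / 2 ^+ n < r.
  have [n Hn] : exists n : nat, S / r < n%:R.
    by exists (Num.bound (S / r)); apply: archi_boundP; rewrite divr_ge0// ltW.
  exists n; rewrite ltr_pdivrMr ?exprn_gt0// mulrC -ltr_pdivrMr//.
  by rewrite (lt_trans Hn)// -natrX ltr_nat ltn_expl.
have lhS : l n + h n = S / 2 ^+ n by rewrite /l /h -mulrDl.
have H : `|K n (z n)| <= 2 * (e / (2 * S ^+ 2 + 1) * (S / 2 ^+ n)) * (S / 2 ^+ n).
  have [g1 g2 g3 g4] := zgood n.
  rewrite -[X in _ * X]lhS.
  rewrite (_ : l n + h n = ((z n).1 + l n - (z n).1) + ((z n).2 + h n - (z n).2)); last by ring.
  apply: (@contour_im_small _ _ _ _ _ _ (f (cpt x0 y0)) w (cpt x0 y0)).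
  - move=> s t /andP[/andP[h1 h2] /andP[h3 h4]]; apply: cf; rewrite /in_rect.
    by apply/andP; split; apply/andP; split; lra.
  - by rewrite lerDl.
  - by rewrite lerDl.
  move=> s t /andP[/andP[h1 h2] /andP[h3 h4]].
  have D : cmod (cpt s t - cpt x0 y0) <= S / 2 ^+ n.
    have -> : cpt s t - cpt x0 y0 = cpt (s - x0) (t - y0) by [].
    rewrite (le_trans (cpt_norm _ _))// -lhS.
    have /andP[u1 u2] := xin n; have /andP[v1 v2] := yin n.
    by apply: lerD; rewrite ler_norml; apply/andP; split; lra.
  apply: (le_trans (rP _ (le_lt_trans D nP))).
  by rewrite ler_wpM2l// ltW.
apply: (le_trans (Kn n)).
apply: (@le_trans _ _ (4 ^+ n * (2 * (e / (2 * S ^+ 2 + 1) * (S / 2 ^+ n)) * (S / 2 ^+ n)))).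
  by rewrite ler_wpM2l ?exprn_ge0.
rewrite (_ : 4 = 2 * 2 :> R); last by ring.
rewrite exprMn (_ : _ * _ = e * (2 * S ^+ 2 / (2 * S ^+ 2 + 1))); last first.
  by field; rewrite expf_neq0//= gt_eqF// ltr_wpDl// mulr_ge0// sqr_ge0.
rewrite ger_pMr// ler_pdivrMr ?mul1r ?lerDl//.
by rewrite ltr_wpDl// mulr_ge0// sqr_ge0.
Qed.

(** The integrals over the horizontal sides cancel. *)
Lemma goursat_periodic (f : C -> C) (a b c d : R) : a <= b -> c <= d ->
  (forall s t, in_rect a b c d s t -> cdiff f (cpt s t)) ->
  (forall s, f (cpt s d) = f (cpt s c)) ->
  rint (fun t => complex.Re (f (cpt b t))) c d =
  rint (fun t => complex.Re (f (cpt a t))) c d.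
Proof.
move=> ab cd df fper; have := goursat ab cd df; rewrite /contour_im.
under [X in _ + (_ - rint X _ _)]eq_fun do rewrite fper.
by rewrite subrr addr0 => /eqP; rewrite subr_eq0 => /eqP.
Qed.

End Goursat.

(** * The mean value inequality and the maximum principle *)

Section MaxPrinciple.
Variable R : realType.
Local Notation C := (Rcomplex R).
Local Notation cmod z := (`|(z : Rcomplex R)|).

Lemma diff_err (V W : normedModType R) (f : V -> W) (x : V) :
  differentiable f x -> forall e : R, 0 < e ->
  \forall h \near (0 : V), `|f (h + x) - f x - 'd f x h| <= e * `|h|.
Proof.
move=> /diff_locally /eqaddoP H e e0; have := H _ e0.
apply: filterS => h; rewrite -[_ h]/(f (h + x) - (f x + 'd f x h)).
by rewrite opprD addrA.
Qed.

Lemma is_derive_err (f : R -> R) (x df : R) : is_derive x 1 f df ->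
  forall e : R, 0 < e ->
  \forall h \near (0 : R), `|f (h + x) - f x - h * df| <= e * `|h|.
Proof.
move=> [/derivable1_diffP dfx E] e e0; have := diff_err dfx e0.
by apply: filterS => h; rewrite deriv1E ?derive1E ?E//; exact/derivable1_diffP.
Qed.

Lemma cdiff_of_err (f : C -> C) (x w : C) :
  (forall e : R, 0 < e -> \forall y \near x,
    cmod (f y - f x - w * (y - x)) <= e * cmod (y - x)) -> cdiff f x.
Proof.
move=> H; exists (fun y => if y == x then w else (f y - f x) / (y - x)).
  apply/ccontP => e e0; have := H e e0; apply: (@filterS _ (nbhs x)) => y.
  rewrite eqxx.
  have [->|yx] := eqVneq y x; first by move=> _; rewrite subrr normr0 ltW.
  have yx0 : 0 < cmod (y - x) by rewrite normr_gt0 subr_eq0.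
  rewrite -[X in _ -> is_true X](ler_pM2r yx0) => He; apply: le_trans He.
  have -> : f y - f x - w * (y - x) = - ((w - (f y - f x) / (y - x)) * (y - x)).
    by rewrite mulrBl divfK ?subr_eq0//; ring.
  by rewrite normrN cnormM.
move=> y; case: eqP => [->|/eqP yx]; first by rewrite subrr mulr0 addr0.
by rewrite divfK ?subr_eq0// addrC subrK.
Qed.

(** A holomorphic function restricts to a holomorphic function of one variable
on a complex line. *)
Lemma cdiff_line (V : normedModType R) (J : V -> V) (f : V -> C) (e : V) (z : C) :
  let L := fun z : C => complex.Re z *: e + complex.Im z *: J e in
  holomorphic_at J f (L z) -> cdiff (fun z => f (L z)) z.
Proof.
move=> L [df Jf].
have LB y : L y = L (y - z) + L z.
  by rewrite /L !raddfB /= !scalerBl addrACA !subrK.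
have Ln y : `|L y| <= (`|e| + `|J e| + 1) * cmod y.
  rewrite (le_trans (ler_normD _ _))// !normrZ.
  rewrite (@le_trans _ _ (cmod y * `|e| + cmod y * `|J e|))//.
    by rewrite lerD// ler_wpM2r// ?cnorm_Re ?cnorm_Im.
  by rewrite -mulrDr mulrC ler_wpM2r// lerDl.
apply: (@cdiff_of_err _ _ ('d f (L z) e)) => r r0.
set k := `|e| + `|J e| + 1 in Ln *.
have k0 : 0 < k by rewrite /k ltr_wpDl// addr_ge0.
have /(@nbhs_normP R V)[d /= d0 H] := diff_err df (divr_gt0 r0 k0).
apply/near_cP; exists (d / k) => [|y yz]; first by rewrite divr_gt0.
have : `|L (y - z)| < d.
  by rewrite (le_lt_trans (Ln _))// mulrC -ltr_pdivlMr.
rewrite -[X in X < _]normrN -sub0r => /H /=; rewrite -LB.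
have -> : 'd f (L z) (L (y - z)) = (y - z) * 'd f (L z) e.
  by rewrite cmulE /L linearD !linearZ /= Jf.
rewrite mulrC => /le_trans -> //.
by rewrite -mulrA ler_wpM2l ?(ltW r0)// mulrC ler_pdivrMr// mulrC.
Qed.

(** Used to turn an annulus into a rectangle; differentiability is obtained at
0 from the real derivatives of exp, cos and sin, and moved by the addition
formula. *)
Definition cexp (z : C) : C :=
  cpt (expR (complex.Re z) * cos (complex.Im z)) (expR (complex.Re z) * sin (complex.Im z)).

Lemma cexpD z w : cexp (z + w) = cexp z * cexp w.
Proof.
case: z w => [x y] [u v]; rewrite /cexp /cpt /= expRD cosD sinD.
by simpc; congr Complex; ring.
Qed.

Lemma cexp_norm z : cmod (cexp z) = expR (complex.Re z).
Proof.
rewrite cnormE /= !exprMn -mulrDr cos2Dsin2 mulr1 sqrtr_sqr ger0_norm// expR_ge0.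
Qed.

Lemma cdiff_cexp0 : cdiff cexp 0.
Proof.
apply: (@cdiff_of_err _ _ 1) => e e0.
have e1 : 0 < Num.min (e / 6) 1 by rewrite lt_min divr_gt0 ?ltr01.
set e' := Num.min _ _ in e1.
have he : 6 * e' <= e by rewrite -ler_pdivlMl// mulrC ge_min lexx.
have he1 : e' <= 1 by rewrite ge_min lexx orbT.
have /(@nbhs_normP R R)[d1 /= d10 H1] := is_derive_err (is_derive_expR 0) e1.
have /(@nbhs_normP R R)[d2 /= d20 H2] := is_derive_err (is_derive_cos 0) e1.
have /(@nbhs_normP R R)[d3 /= d30 H3] := is_derive_err (is_derive_sin 0) e1.
apply/near_cP; exists (Num.min (Num.min d1 d2) (Num.min d3 (e' / 2))).
  by rewrite !lt_min d10 d20 d30 divr_gt0.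
case=> x y; rewrite subr0 !lt_min => /andP[/andP[h1 h2] /andP[h3 h4]].
set z := (x +i* y)%C : C.
have hx : `|x| <= cmod z := cnorm_Re z.
have hy : `|y| <= cmod z := cnorm_Im z.
have := H1 x; rewrite /= sub0r normrN => /(_ (le_lt_trans hx h1)).
have := H2 y; rewrite /= sub0r normrN => /(_ (le_lt_trans hy h2)).
have := H3 y; rewrite /= sub0r normrN => /(_ (le_lt_trans hy h3)).
rewrite !addr0 expR0 cos0 sin0 oppr0 mulr0 !subr0 ?addr0 !mulr1 => K3 K2 K1.
have -> : cexp z - cexp 0 - 1 * z =
    cpt ((expR x - 1 - x) + expR x * (cos y - 1)) (expR x * (sin y - y) + (expR x - 1) * y).
  rewrite /cexp /cpt /= expR0 cos0 sin0 mul1r; simpc.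
  by congr Complex; ring.
rewrite (le_trans (cpt_norm _ _))//.
have z0 : 0 <= cmod z := normr_ge0 _.
have eb : `|expR x - 1| <= e'.
  have -> : expR x - 1 = (expR x - 1 - x) + x by ring.
  rewrite (le_trans (ler_normD _ _))//.
  have : e' * `|x| <= 1 * `|x| by rewrite ler_wpM2r.
  lra.
have eb2 : `|expR x| <= 2.
  have -> : expR x = (expR x - 1) + 1 by ring.
  by rewrite (le_trans (ler_normD _ _))// normr1; lra.
have E1 : `|expR x * (cos y - 1)| <= 2 * (e' * cmod z).
  by rewrite normrM ler_pM// (le_trans K2)// ler_wpM2l// ltW.
have E2 : `|expR x * (sin y - y)| <= 2 * (e' * cmod z).
  by rewrite normrM ler_pM// (le_trans K3)// ler_wpM2l// ltW.
have E3 : `|(expR x - 1) * y| <= e' * cmod z by rewrite normrM ler_pM.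
have E4 : `|expR x - 1 - x| <= e' * cmod z.
  by rewrite (le_trans K1)// ler_wpM2l// ltW.
have E5 : 6 * e' * cmod z <= e * cmod z by rewrite ler_wpM2r.
rewrite (le_trans _ E5)//.
rewrite (le_trans (lerD (ler_normD _ _) (ler_normD _ _)))//; lra.
Qed.

Lemma cdiff_cexp z : cdiff cexp z.
Proof.
have -> : cexp = (fun y => cexp z * cexp (y - z)).
  by apply/funext => y; rewrite -cexpD addrC subrK.
apply: cdiffM; first exact: cdiff_cst.
apply: (@cdiff_comp _ cexp (fun y => y - z)).
  by apply: cdiffB; [exact: cdiff_id|exact: cdiff_cst].
by rewrite subrr; exact: cdiff_cexp0.
Qed.

(** In the coordinate z with x = a + exp z an annulus around a becomes a
rectangle of height 2 pi, on which g is periodic.  By [goursat_periodic] the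
mean of Re g over a circle around a does not depend on the radius.  It is at
most m for the radius rho and tends to Re (g a) for small radii.  The centre is
left out of the differentiability because g may come from a removable
singularity. *)
Lemma mean_le (g : C -> C) (a : C) (rho rho' m : R) : 0 < rho -> rho < rho' ->
  ccont g a -> (forall x, 0 < cmod (x - a) < rho' -> cdiff g x) ->
  (forall x, cmod (x - a) = rho -> complex.Re (g x) <= m) ->
  complex.Re (g a) <= m.
Proof.
move=> rho0 rr' cg dg gm; apply/ler_addgt0Pr => e e0.
have /near_cP[d d0 gd] := (ccontP g a).1 cg e e0.
pose r0 := Num.min d rho / 2.
have r00 : 0 < r0 by rewrite divr_gt0// lt_min d0.
have r0d : r0 < d.
  by rewrite /r0 ltr_pdivrMr// (@le_lt_trans _ _ d)// ?ge_min ?lexx//; lra.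
have r0r : r0 < rho.
  by rewrite /r0 ltr_pdivrMr// (@le_lt_trans _ _ rho)// ?ge_min ?lexx ?orbT//; lra.
pose s0 := ln r0; pose s1 := ln rho.
have s01 : s0 <= s1 by rewrite /s0 /s1 ler_ln ?posrE// ltW.
have es0 : expR s0 = r0 by rewrite lnK// posrE.
have es1 : expR s1 = rho by rewrite lnK// posrE.
pose F z := g (a + cexp z).
have FE : F = fun z => g (a + cexp z) by [].
clearbody F.
have [P [P0 cosP sinP]] : exists P : R, [/\ 0 < P, cos P = 1 & sin P = 0].
  by exists (pi *+ 2); rewrite mulrn_wgt0 ?pi_gt0// cos2pi sin2pi.
have FN z : cmod (a + cexp z - a) = expR (complex.Re z).
  by rewrite addrC addKr cexp_norm.
have dF s t : in_rect s0 s1 0 P s t -> cdiff F (cpt s t).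
  move=> /andP[/andP[ss ss'] _]; rewrite FE; apply: (@cdiff_comp _ g (fun z => a + cexp z)).
    by apply: cdiffD; [exact: cdiff_cst|exact: cdiff_cexp].
  apply: dg; rewrite FN /= expR_gt0 (le_lt_trans _ rr')//.
  by rewrite -es1 ler_expR.
have := @goursat_periodic _ F _ _ _ _ s01 (ltW P0) dF.
have Fper s : F (cpt s P) = F (cpt s 0).
  by rewrite FE /cexp /= sinP cosP sin0 cos0.
move=> /(_ Fper) E.
have cF s : s0 <= s <= s1 ->
    cont_on (fun t => complex.Re (F (cpt s t))) 0 P.
  apply: (@cont_Re_vert _ _ s0 s1) => x y xy; exact/cdiff_cont/dF.
have := @rint_le _ _ _ _ _ (cF s1 _) (@cont_on_cst _ m 0 P).
rewrite s01 lexx => /(_ isT) H1.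
have {H1} : rint (fun t => complex.Re (F (cpt s1 t))) 0 P <= m * P.
  rewrite -[X in _ * X]subr0 -rint_cst ?(ltW P0)//; apply: H1 => t _.
  by rewrite FE; apply: gm; rewrite FN.
rewrite E => H1.
have := @rint_near_cst _ _ (complex.Re (g a)) e _ _ (ltW P0) (cF s0 _).
rewrite s01 lexx subr0 => /(_ isT) H2.
have {H2} : `|rint (fun t => complex.Re (F (cpt s0 t))) 0 P - complex.Re (g a) * P| <= e * P.
  apply: H2 => t _.
  rewrite FE distrC -raddfB (le_trans (cnorm_Re _))//; apply: gd.
  by rewrite FN /= es0.
move: H1; move: (rint _ _ _) => A H1.
rewrite ler_norml => /andP[H2 _]; rewrite -(ler_pM2r P0) mulrDl.
by move: H1 H2; move: (m * P) (complex.Re (g a) * P) (e * P) => u v w; lra.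
Qed.

Lemma cnorm2 (z : C) : cmod z ^+ 2 = complex.Re z ^+ 2 + complex.Im z ^+ 2.
Proof. by rewrite cnormE sqr_sqrtr// addr_ge0 ?sqr_ge0. Qed.

Lemma disc_argmax (phi : C -> R) (r : R) : 0 <= r ->
  (forall x : C, cmod x <= r -> {for x, continuous phi}) ->
  exists2 p : C, cmod p <= r & forall x : C, cmod x <= r -> phi x <= phi p.
Proof.
move=> r0 cphi.
pose c2 := fun st : R * R => cpt st.1 st.2 : C.
have c2c : continuous c2.
  apply: (@lipschitz_cont R (R * R)%type C c2 2) => -[x y] [u v].
  have -> : c2 (x, y) - c2 (u, v) = cpt (x - u) (y - v) by [].
  rewrite (le_trans (cpt_norm _ _))// prod_normE /= mulr_natl mulr2n.
  by apply: lerD; rewrite le_max lexx ?orbT.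
pose A := [set st : R * R | cmod (c2 st) <= r].
have cA : compact A.
  apply: (@subclosed_compact _ _ (`[- r, r] `*` `[- r, r])).
  - have -> : A = (fun st : R * R => cmod (c2 st)) @^-1` [set x | x <= r] by [].
    apply: preimage_closed; last exact: closed_le.
    move=> st _; apply: (@continuous_comp _ C); first exact: c2c.
    exact: norm_continuous.
  - apply: compact_setX; exact: segment_compact.
  move=> [x y] /= H; rewrite /A /= in H; split; rewrite /= in_itv /= -ler_norml.
    exact: le_trans (cnorm_Re (cpt x y)) H.
  exact: le_trans (cnorm_Im (cpt x y)) H.
have A0 : A !=set0.
  exists (0, 0); rewrite /A /c2 /= (le_trans (cpt_norm _ _))//.
  by rewrite normr0 addr0.
have [|[x y]] := @compact_EVT_max _ R (phi \o c2) A A0 cA.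
  apply: continuous_in_subspaceT => st; rewrite inE => Ast.
  by apply: continuous_comp; [exact: c2c|exact: cphi].
rewrite inE => Axy H; exists (cpt x y) => // -[u v] uv.
by apply: (H (u, v)); rewrite inE.
Qed.

(** The function Re (c G x) + |x|^2, where |c| = 1 and c (G 0) = |G 0|, has a
maximum p on the disc.  If p is interior, then near p the function is
Re (g x) + |x - p|^2 up to a constant, where
g x = c (G x) + 2 conj(p) (x - p).  So on a small circle of radius rho around p
the real part of g stays below its value at p by rho^2, against [mean_le].  Thus
p lies on the boundary.  The strictly subharmonic term |x|^2 avoids any
discussion of equality, at the price of r^2 in the bound. *)
Lemma max_principle (G : C -> C) (r M : R) : 0 < r -> 0 <= M ->
  (forall x, cmod x <= r -> ccont G x) ->
  (forall p, cmod p < r -> exists2 d : R, 0 < d &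
     forall x, 0 < cmod (x - p) < d -> cdiff G x) ->
  (forall x, cmod x = r -> cmod (G x) <= M) ->
  cmod (G 0) <= M + r ^+ 2.
Proof.
move=> r0 M0 cG dG GM.
have [->|G0] := eqVneq (G 0) 0; first by rewrite normr0 addr_ge0// sqr_ge0.
pose c : C := cmod (G 0) *: (G 0)^-1.
have cn : cmod c = 1.
  by rewrite /c normrZ cnormV normr_id divff// normr_eq0.
have cG0 : c * G 0 = cmod (G 0) *: 1 by rewrite /c -scalerAl mulVf.
pose phi x := complex.Re (c * G x) + cmod x ^+ 2.
have [|p pr pmax] := @disc_argmax phi r (ltW r0).
  move=> x xr; apply: (@cvgD R R C (nbhs x)).
    apply: (@continuous_comp C C R (fun x => c * G x) (@complex.Re R : C -> R)).
      apply: (@ccontM _ (fun _ => c)); [exact: ccont_cst|exact: cG].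
    exact: Re_continuous.
  apply: (@cvgM R C (nbhs x)); exact: norm_continuous.
have phi0 : phi 0 = cmod (G 0).
  by rewrite /phi cG0 normr0 expr0n addr0 /= mulr1.
have p0 : phi 0 <= phi p by apply: pmax; rewrite normr0 ltW.
have [pr'|rp] := ltP (cmod p) r; last first.
  have {}pr : cmod p = r by apply/eqP; rewrite eq_le pr rp.
  rewrite -phi0 (le_trans p0)// /phi pr lerD2r.
  by rewrite (le_trans (ler_norm _))// (le_trans (cnorm_Re _))// cnormM cn mul1r GM.
exfalso; have [d d0 dGp] := dG _ pr'.
pose rho' := Num.min d (r - cmod p).
have rho'0 : 0 < rho' by rewrite lt_min d0 subr_gt0.
pose rho := rho' / 2.
have rho0 : 0 < rho by rewrite divr_gt0.
have rr' : rho < rho' by rewrite ltr_pdivrMr//; lra.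
pose pc : C := cpt (complex.Re p) (- complex.Im p).
pose g x := c * G x + (2 : R) *: (pc * (x - p)).
have gE x : phi x = complex.Re (g x) + cmod p ^+ 2 + cmod (x - p) ^+ 2.
  rewrite /phi /g raddfD /= !cnorm2; move: (complex.Re (c * G x)) => u.
  rewrite /pc /cpt; case: (x) => x1 x2; case: (p) => p1 p2 /=; ring.
have dg x : cdiff G x -> cdiff g x.
  move=> dGx; have -> : g = fun x => c * G x + ((2 : R) *: pc) * (x - p).
    by apply/funext => y; rewrite /g scalerAl.
  apply: cdiffD; first by apply: cdiffM => //; exact: cdiff_cst.
  apply: cdiffM; first exact: cdiff_cst.
  by apply: cdiffB; [exact: cdiff_id|exact: cdiff_cst].
have cg : ccont g p.
  have -> : g = fun x => c * G x + ((2 : R) *: pc) * (x - p).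
    by apply/funext => y; rewrite /g scalerAl.
  apply: ccontD; first by apply: ccontM; [exact: ccont_cst|exact: cG].
  apply: cdiff_cont; apply: cdiffM; first exact: cdiff_cst.
  by apply: cdiffB; [exact: cdiff_id|exact: cdiff_cst].
have := @mean_le g p rho rho' (complex.Re (g p) - rho ^+ 2) rho0 rr' cg.
have H1 x : 0 < cmod (x - p) < rho' -> cdiff g x.
  move=> /andP[h1 h2]; apply/dg/dGp; rewrite h1 (lt_le_trans h2)//.
  by rewrite /rho' ge_min lexx.
have H2 x : cmod (x - p) = rho -> complex.Re (g x) <= complex.Re (g p) - rho ^+ 2.
  move=> xp; have : cmod x <= r.
    have -> : x = (x - p) + p by rewrite subrK.
    rewrite (le_trans (ler_normD _ _))// xp.
    have : rho' <= r - cmod p by rewrite ge_min lexx orbT.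
    by move: rr'; lra.
  move=> /pmax; rewrite (gE x) (gE p) subrr normr0 expr0n addr0 xp; lra.
move=> /(_ H1 H2); have := exprn_gt0 2 rho0; lra.
Qed.

Lemma ccont_sum (I : Type) (s : seq I) (F : I -> C -> C) (x : C) :
  (forall i, ccont (F i) x) -> ccont (fun y => \sum_(i <- s) F i y) x.
Proof.
move=> cF; elim: s => [|i s IH].
  by under eq_fun do rewrite big_nil; exact: ccont_cst.
by under eq_fun do rewrite big_cons; exact: ccontD.
Qed.

(** The quotient (h x - h a) / (x^N - a^N) extends continuously to the N-th
roots of a^N, because h equals h a there.  On the circle of radius r it is
bounded independently of a, as soon as |a| < r / 2; by the maximum principle it
is bounded at x = 0, where it is (h a - h 0) / a^N. *)
Lemma invariant_bound (h : C -> C) (N : nat) : (0 < N)%N ->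
  (\forall x \near (0 : C), cdiff h x) ->
  (forall x y : C, x ^+ N = y ^+ N -> h x = h y) ->
  exists2 K : R, 0 < K &
    \forall x \near (0 : C), cmod (h x - h 0) <= K * cmod x ^+ N.
Proof.
move=> N0 /near_cP[r1 r10 dh1] hinv.
have dh x : cmod x < r1 -> cdiff h x by move=> xr; apply: dh1; rewrite subr0.
have c0 : ccont h 0 by apply/cdiff_cont/dh; rewrite normr0.
have /near_cP[r2 r20 bh1] := (ccontP h 0).1 c0 _ ltr01.
have bh x : cmod x < r2 -> cmod (h 0 - h x) <= 1.
  by move=> xr; apply: bh1; rewrite subr0.
pose r := Num.min r1 r2 / 2.
have r12 : 0 < Num.min r1 r2 by rewrite lt_min r10.
have r0 : 0 < r by rewrite divr_gt0.
have rr : r < Num.min r1 r2 by rewrite ltr_pdivrMr//; lra.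
have rr1 : r < r1 by rewrite (lt_le_trans rr)// ge_min lexx.
have rr2 : r < r2 by rewrite (lt_le_trans rr)// ge_min lexx orbT.
pose M := 2 / (r ^+ N - (r / 2) ^+ N).
have D0 : 0 < r ^+ N - (r / 2) ^+ N.
  by rewrite subr_gt0 ltr_pXn2r ?nnegrE ?ltW ?divr_gt0// ltr_pdivrMr//; lra.
have M0 : 0 <= M by rewrite divr_ge0// ltW.
exists (M + r ^+ 2); first by rewrite ltr_wpDl// exprn_gt0.
apply/near_cP; exists (r / 2) => [|a]; first by rewrite divr_gt0.
rewrite subr0 => ar.
have [->|a0] := eqVneq a 0.
  by rewrite subrr normr0 mulr_ge0// ?exprn_ge0// addr_ge0// sqr_ge0.
have ar' : cmod a < r by rewrite (lt_trans ar)// ltr_pdivrMr//; lra.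
(* v is the value of the extension at a root p of a^N: the quotient of the
   derivatives of h and of the N-th power. *)
have exc (p : C) : exists v : C, cmod p < r1 -> p ^+ N = a ^+ N ->
    exists2 q : C -> C, ccont q p /\ q p = v &
      \forall y \near p, y != p -> y ^+ N != a ^+ N /\
        (h y - h a) / (y ^+ N - a ^+ N) = q y.
  have [pr|] := boolP (cmod p < r1); last by exists 0.
  have [phi cphi hphi] := dh _ pr.
  pose psi (y : C) : C := \sum_(i < N) y ^+ (N.-1 - i) * p ^+ i.
  have psiE y : y ^+ N - p ^+ N = psi y * (y - p).
    by rewrite /psi mulrC subrXX.
  have [pa|] := boolP (p ^+ N == a ^+ N); last by exists 0 => _ /eqP; rewrite (negbTE i).
  have p0 : p != 0.
    apply: contraNneq a0 => p0; move: pa; rewrite p0 expr0n (gtn_eqF N0).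
    by rewrite eq_sym expf_eq0 N0.
  have psip : psi p != 0.
    rewrite /psi (eq_bigr (fun _ => p ^+ N.-1)); last first.
      by move=> i _; rewrite -exprD subnK// -ltnS prednK.
    rewrite sumr_const card_ord -mulr_natr mulf_neq0 ?expf_neq0//.
    by rewrite (@pnatr_eq0 R[i]) -lt0n.
  have cpsi : ccont psi p.
    apply: ccont_sum => i; apply: cdiff_cont; apply: cdiffM.
      by apply: cdiffX; exact: cdiff_id.
    exact: cdiff_cst.
  exists (phi p / psi p) => _ _; exists (fun y => phi y / psi y).
    by split=> //; apply: ccontM => //; apply: ccontV.
  have := near_neq0 cpsi psip; apply: (@filterS _ (nbhs p)) => y py yp.
  have E : y ^+ N - a ^+ N = psi y * (y - p) by rewrite -(eqP pa) psiE.
  have yp0 : y - p != 0 by rewrite subr_eq0.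
  split; first by rewrite -subr_eq0 E mulf_neq0.
  rewrite E -(hinv _ _ (eqP pa)) hphi addrC addKr.
  by field; rewrite py yp0.
have /choice[v vP] := exc.
(* The quotient with its removable singularities filled in. *)
pose G (x : C) : C := if x ^+ N == a ^+ N then v x else (h x - h a) / (x ^+ N - a ^+ N).
have dG (x : C) : cmod x < r1 -> x ^+ N != a ^+ N -> cdiff G x.
  move=> xr xa.
  have dN : cdiff (fun y : C => y ^+ N - a ^+ N) x.
    by apply: cdiffB; [apply: cdiffX; exact: cdiff_id|exact: cdiff_cst].
  have xa0 : x ^+ N - a ^+ N != 0 by rewrite subr_eq0.
  apply: (@cdiff_eq_near _ (fun y => (h y - h a) / (y ^+ N - a ^+ N))).
    have := near_neq0 (cdiff_cont dN) xa0; apply: (@filterS _ (nbhs x)) => y.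
    by rewrite subr_eq0 /G => /negbTE ->.
  apply: cdiffM; last exact: cdiffV.
  by apply: cdiffB; [exact: dh|exact: cdiff_cst].
have cG (x : C) : cmod x < r1 -> ccont G x.
  move=> xr; have [xa|] := eqVneq (x ^+ N) (a ^+ N); last by move=> /(dG _ xr)/cdiff_cont.
  have [q [cq qx] qn] := vP _ xr xa.
  apply: ccont_eq_near cq; move: qn; apply: (@filterS _ (nbhs x)) => y.
  have [-> _|yx /(_ isT)[ya <-]] := eqVneq y x; first by rewrite /G xa eqxx.
  by rewrite /G (negbTE ya).
have := @max_principle G r M r0 M0.
have H1 x : cmod x <= r -> ccont G x by move=> xr; apply: cG; exact: le_lt_trans rr1.
have H2 p : cmod p < r -> exists2 d : R, 0 < d &
     forall x, 0 < cmod (x - p) < d -> cdiff G x.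
  move=> pr; have pr1 := lt_trans pr rr1.
  suff /near_cP[d d0 H] : \forall y \near p, y != p -> y ^+ N != a ^+ N.
    exists (Num.min d (r1 - cmod p)); first by rewrite lt_min d0 subr_gt0.
    move=> x; rewrite lt_min => /andP[h1 /andP[h2 h3]]; apply: dG.
      have -> : x = (x - p) + p by rewrite subrK.
      by rewrite (le_lt_trans (ler_normD _ _))//; lra.
    by apply: H => //; rewrite -subr_eq0 -normr_gt0.
  have [pa|pa] := eqVneq (p ^+ N) (a ^+ N).
    have [q _ qn] := vP _ pr1 pa.
    by move: qn; apply: (@filterS _ (nbhs p)) => y H /H[].
  have dN : cdiff (fun y : C => y ^+ N - a ^+ N) p.
    by apply: cdiffB; [apply: cdiffX; exact: cdiff_id|exact: cdiff_cst].
  have pa0 : p ^+ N - a ^+ N != 0 by rewrite subr_eq0.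
  have := near_neq0 (cdiff_cont dN) pa0; apply: (@filterS _ (nbhs p)) => y.
  by rewrite subr_eq0.
have H3 x : cmod x = r -> cmod (G x) <= M.
  move=> xr; have hd : r ^+ N - (r / 2) ^+ N <= cmod (x ^+ N - a ^+ N).
    rewrite (le_trans _ (lerB_dist _ _))// !cnormX xr lerB//.
    by rewrite ler_pXn2r ?nnegrE// ltW// divr_gt0.
  have xa : x ^+ N != a ^+ N.
    by rewrite -subr_eq0 -normr_gt0 (lt_le_trans D0).
  rewrite /G (negbTE xa) cnormM cnormV /M ler_pM ?invr_ge0//.
    have -> : h x - h a = (h 0 - h a) - (h 0 - h x) by ring.
    rewrite (le_trans (ler_normB _ _))//.
    have := bh a (lt_trans ar' rr2); have := bh x; rewrite xr => /(_ rr2); lra.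
  by rewrite lef_pV2 ?posrE// (lt_le_trans D0).
move=> /(_ H1 H2 H3).
have aN0 : a ^+ N != 0 by rewrite expf_neq0.
rewrite /G expr0n (gtn_eqF N0) eq_sym (negbTE aN0) sub0r cnormM cnormV normrN cnormX.
rewrite ler_pdivrMr; last by rewrite exprn_gt0// normr_gt0.
by rewrite distrC.
Qed.

End MaxPrinciple.

(** * Holomorphic functions on a complex normed space *)

Section Holo.
Variable R : realType.
Local Notation C := (Rcomplex R).
Local Notation cmod z := (`|(z : Rcomplex R)|).

(** A constant that can carry the structure of a bilinear map, for the rule that
differentiates a product. *)
Definition cmul (z w : C) : C := z * w.

Lemma cmul_bilinear : bilinear_for
  (GRing.Scale.Law.clone _ _ *:%R _) (GRing.Scale.Law.clone _ _ *:%R _) cmul.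
Proof.
rewrite /cmul; split=> [u' u v w|u' u v w]; first by rewrite mulrDl -scalerAl.
by rewrite mulrDr (mulrC u') -scalerAl (mulrC v).
Qed.

HB.instance Definition _ := bilinear_isBilinear.Build R C C C _ _ cmul
  cmul_bilinear.

Lemma cmul_continuous : continuous (fun p : C * C => cmul p.1 p.2).
Proof.
move=> p; apply: (@ccvgM R (C * C)%type (nbhs p) _ fst snd); [exact: cvg_fst|exact: cvg_snd].
Qed.

Variables (V : normedModType R) (J : V -> V).

Lemma holomorphic_near (f g : V -> C) (x : V) : (\forall y \near x, f y = g y) ->
  holomorphic_at J f x -> holomorphic_at J g x.
Proof.
move=> fg [df Jf].
have fgx : f x = g x by exact: nbhs_singleton fg.
have E : g \o shift x = cst (g x) + 'd f x +o_ 0 id.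
  apply/eqaddoP => e e0.
  have fg0 : \forall h \near (0 : V), f (h + x) = g (h + x).
    move: fg => /(@nbhs_normP R V)[d /= d0 H].
    apply/(@nbhs_normP R V); exists d => // h; rewrite /= sub0r normrN => hd.
    by apply: H; rewrite /= distrC addrK.
  near=> h; rewrite -[_ h]/(g (h + x) - (g x + 'd f x h)) opprD addrA.
  rewrite -fgx -(near fg0 h)//; near: h; exact: diff_err.
have gf : 'd g x = 'd f x :> (V -> C).
  by apply: diff_unique => //; exact: diff_continuous.
split; last by move=> v; rewrite gf.
by apply/diff_locallyP; rewrite gf; split => //; exact: diff_continuous.
Unshelve. all: by end_near. Qed.

Lemma diff_cmul (f g : V -> C) (x : V) :
  differentiable f x -> differentiable g x ->
  differentiable (fun y => f y * g y : C) x /\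
  forall v, 'd (fun y => f y * g y : C) x v = f x * 'd g x v + 'd f x v * g x.
Proof.
move=> df dg.
have dp : differentiable (fun y => (f y, g y)) x by exact: differentiable_pair.
have dm : differentiable (fun p : C * C => cmul p.1 p.2) (f x, g x).
  exact: (differentiable_bilin (f x, g x) cmul_continuous).
split.
  exact: (@differentiable_comp R V (C * C)%type C (fun y => (f y, g y)) (fun p => cmul p.1 p.2) x dp dm).
move=> v.
rewrite (@diff_comp R V (C * C)%type C (fun y => (f y, g y)) (fun p => cmul p.1 p.2) x dp dm) /=.
rewrite (diff_bilin (f x, g x) cmul_continuous) /=.
by rewrite (diff_pair df dg).
Qed.

Lemma holomorphicM (f g : V -> C) (x : V) :
  holomorphic_at J f x -> holomorphic_at J g x ->
  holomorphic_at J (fun y => f y * g y : C) x.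
Proof.
move=> [df Jf] [dg Jg]; have [d E] := diff_cmul df dg.
split=> // v; rewrite !E Jf Jg mulrDr.
by congr (_ + _); [exact: mulrCA|exact: (esym (mulrA _ _ _))].
Qed.

Lemma holomorphic_cst (c : C) (x : V) : holomorphic_at J (fun _ => c) x.
Proof.
split; first exact: differentiable_cst.
by move=> v; rewrite (diff_cst c x) mulr0.
Qed.

Lemma holomorphicX (f : V -> C) (n : nat) (x : V) :
  holomorphic_at J f x -> holomorphic_at J (fun y => f y ^+ n : C) x.
Proof.
move=> hf; elim: n => [|n IH]; first exact: holomorphic_cst.
by under eq_fun do rewrite exprS; exact: holomorphicM.
Qed.

Lemma diff_lincomb (I : Type) (s : seq I) (c : I -> C) (f : I -> V -> C) (x : V) :
  (forall i, differentiable (f i) x) ->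
  differentiable (fun y => \sum_(i <- s) c i * f i y : C) x /\
  forall v, 'd (fun y => \sum_(i <- s) c i * f i y : C) x v =
            \sum_(i <- s) c i * 'd (f i) x v.
Proof.
move=> df; elim: s => [|i s [IH1 IH2]].
  under eq_fun do rewrite big_nil.
  split; first exact: differentiable_cst.
  by move=> v; rewrite big_nil (@diff_cst R V C 0 x).
under eq_fun do rewrite big_cons.
have [d E] := diff_cmul (differentiable_cst (c i) x) (df i).
split; first exact: (differentiableD d IH1).
move=> v; rewrite big_cons (diffD d IH1) /= IH2; congr (_ + _).
by rewrite E (diff_cst (c i) x) mul0r addr0.
Qed.

Lemma holomorphic_linear (f : {linear V -> C}) (x : V) :
  continuous f -> (forall v, f (J v) = ('i%C : C) * f v) -> holomorphic_at J f x.
Proof.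
move=> cf Jf; split; first exact: linear_differentiable.
by move=> v; rewrite (diff_lin x cf) Jf.
Qed.

End Holo.

(** * Quotients of the plane by cyclic groups of even order are singular *)

Section Cyclic.
Variable R : realType.
Local Notation C := (Rcomplex R).
Local Notation cmod z := (`|(z : Rcomplex R)|).
Local Notation V2 := (C * C)%type.
Let J2 (p : V2) : V2 := (('i%C : C) * p.1, ('i%C : C) * p.2).

Lemma holomorphic_fst (x : V2) : holomorphic_at J2 (fst : V2 -> C) x.
Proof. by apply: holomorphic_linear => // p; exact: cvg_fst. Qed.

Lemma holomorphic_snd (x : V2) : holomorphic_at J2 (snd : V2 -> C) x.
Proof. by apply: holomorphic_linear => // p; exact: cvg_snd. Qed.

Lemma Clinear_pair (D : {linear V2 -> C}) (v : V2) :
  (forall v, D (J2 v) = ('i%C : C) * D v) ->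
  D v = v.1 * D ((1, 0) : V2) + v.2 * D ((0, 1) : V2).
Proof.
move=> DJ; have E : v = (complex.Re v.1 *: ((1, 0) : V2) + complex.Im v.1 *: J2 (1, 0)) +
    (complex.Re v.2 *: ((0, 1) : V2) + complex.Im v.2 *: J2 (0, 1)).
  case: v => a b; rewrite /J2 /=; congr pair => /=; rewrite !mulr0 !scaler0 ?addr0 ?add0r.
    by rewrite -cmulE mulr1.
  by rewrite -cmulE mulr1.
by rewrite {1}E !linearD !linearZ /= !DJ -!cmulE.
Qed.

(** The vectors (a i, b i) are three vectors of a plane. *)
Lemma three_functionals (a b : 'I_3 -> C) : exists2 c : 'I_3 -> C,
  (exists i, c i != 0) & \sum_i c i * a i = 0 /\ \sum_i c i * b i = 0.
Proof.
pose A : 'M[C]_(3, 2) := \matrix_(i, j) (if j == 0 then a i else b i).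
have kA : kermx A != 0.
  rewrite -mxrank_eq0 mxrank_ker -lt0n subn_gt0.
  by rewrite (leq_ltn_trans (rank_leq_col _)).
have /rowV0Pn[v vA v0] := kA.
have {}vA : v *m A = 0 by apply/sub_kermxP.
exists (fun i => v 0 i).
  by have /rV0Pn[i vi] := v0; exists i.
have H j : \sum_i v 0 i * A i j = 0 by move/matrixP: vA => /(_ 0 j); rewrite mxE [RHS]mxE.
split; [rewrite -[RHS](H 0)|rewrite -[RHS](H 1)]; apply: eq_bigr => i _; by rewrite mxE.
Qed.

Variable n : nat.
Hypothesis on : odd n.
Local Notation N := n.+1.
Local Notation Y := (orbit_space (mu R n)).
Let piY : V2 -> Y := orbit_pi (mu R n).

(** The point z e moves along a complex line.  On an axis, multiplying z by an
N-th root of unity is the action of an element of mu_N or of its inverse.  On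
any line, changing the sign of z is the action of -1, which belongs to mu_N as N
is even. *)
Lemma piY_root (z w : C) (e : V2) (k : nat) :
  (e.1 = 0 \/ e.2 = 0) /\ k = N \/ k = 2%N -> z ^+ k = w ^+ k ->
  piY (z * e.1, z * e.2) = piY (w * e.1, w * e.2).
Proof.
move=> ek zw.
have [z0|z0] := eqVneq z 0.
  have k0 : (0 < k)%N by case: ek => [[_ ->]|->].
  move: zw; rewrite z0 expr0n (gtn_eqF k0) => /esym/eqP.
  by rewrite expf_eq0 k0 => /eqP ->.
pose u := w / z.
have uk : u ^+ k = 1 by rewrite expr_div_n zw divff// -zw expf_neq0.
have uN : u ^+ N = 1.
  case: ek => [[_ <-]//|k2]; rewrite -(odd_double_half N) /= on /= add0n.
  by rewrite -muln2 mulnC exprM -k2 uk expr1n.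
have w_eq : w = u * z by rewrite /u divfK.
have u0 : u != 0.
  by apply: contra_eq_neq uN => ->; rewrite expr0n/= eq_sym oner_neq0.
apply/orbit_piP; case: ek => [[ek _]|k2].
  case: ek => ek.
    exists (diag_act u^-1); first by exists u^-1 => //; rewrite exprVn uN invr1.
    by rewrite /diag_act /= ek !mulr0 invrK w_eq mulrA.
  exists (diag_act u); first by exists u.
  by rewrite /diag_act /= ek !mulr0 w_eq mulrA.
exists (diag_act u); first by exists u.
have ui : u^-1 = u by apply: (mulfI u0); rewrite divff// -expr2 -k2.
by rewrite /diag_act /= ui w_eq !mulrA.
Qed.

Lemma eq0_small (c : C) (K : R) : (forall e, 0 < e -> cmod c <= e * K) -> c = 0.
Proof.
move=> H; apply/eqP; rewrite -normr_le0; apply/ler_addgt0Pr => e e0; rewrite add0r.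
have K1 : 0 < `|K| + 1 by rewrite ltr_wpDl.
rewrite (le_trans (H _ (divr_gt0 e0 K1)))// -mulrA ger_pMr// mulrC ler_pdivrMr// mul1r.
by rewrite (le_trans (ler_norm _))// lerDl.
Qed.

(** The invariants x y, x^N and y^N cannot all be holomorphic functions of two
local coordinates: see the beginning of the file. *)
Lemma cyclic_singular : ~ germ_iso (piY (0, 0)) ((0, 0) : C2 R).
Proof.
move=> [U [V [phi [psi [[oU oV U0 V0 phi0] [phiUV psiVU phiK psiK] _ hol]]]]].
pose P (i : 'I_3) (x : V2) : C :=
  if i == 0 then x.1 * x.2 else if i == 1 then x.1 ^+ N else x.2 ^+ N.
have Phol i x : holomorphic_at J2 (P i) x.
  rewrite /P; case: eqP => _; [|case: eqP => _].
  - by apply: holomorphicM; [exact: holomorphic_fst|exact: holomorphic_snd].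
  - by apply: holomorphicX; exact: holomorphic_fst.
  - by apply: holomorphicX; exact: holomorphic_snd.
have Pinv i (x y : V2) : piY x = piY y -> P i x = P i y.
  move=> /orbit_piP[_ [z zN ->] <-]; have z0 : z != 0.
    by apply: contra_eq_neq zN => ->; rewrite expr0n/= eq_sym oner_neq0.
  rewrite /P /diag_act /= !exprMn exprVn zN invr1 !mul1r.
  by case: eqP => // _; rewrite mulrACA divff// mul1r.
pose p i (y : Y) : C := P i (orbit_repr y).
have pE i x : p i (piY x) = P i x by apply: Pinv; exact: orbit_reprK.
pose Phi (x : V2) : V2 := phi (piY x).
have oU' : open (piY @^-1` U) by exact: oU.
have nearU x : U (piY x) -> \forall y \near x, U (piY y).
  by move=> Ux; exact: (open_nbhs_nbhs (conj oU' Ux)).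
have Phihol (g : V2 -> C) : (forall x, holomorphic_at J2 g x) ->
    forall x, U (piY x) -> holomorphic_at J2 (fun x => g (Phi x)) x.
  move=> gh x Ux; have [H _] := hol V g oV (fun _ Vx => Vx).
  have {}H := H (fun x _ => gh x).
  by apply: (H x); split => //; exact: phiUV.
pose F i : V2 -> C := fun v => p i (psi v).
have Fhol i : holomorphic_at J2 (F i) (0, 0).
  have [_ H] := hol V (F i) oV (fun _ Vx => Vx).
  apply: H V0 => x [Ux _].
  apply: holomorphic_near (Phol i x); near=> y; have Uy : U (piY y) by near: y; exact: nearU.
  by rewrite /F /= [psi _](phiK _ Uy) pE.
(* The combination G of the F i has zero differential at the origin. *)
have [c c0 [ca cb]] := three_functionals (fun i => 'd (F i) (0, 0) ((1, 0) : V2))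
   (fun i => 'd (F i) (0, 0) ((0, 1) : V2)).
pose G (v : V2) : C := \sum_i c i * F i v.
have GPhi x : U (piY x) -> G (Phi x) = \sum_i c i * P i x.
  move=> Ux; apply: eq_bigr => i _; rewrite /F /Phi phiK// pE//.
have dG : differentiable G (0, 0) /\ 'd G (0, 0) = (fun _ => 0) :> (V2 -> C).
  have [d E] := @diff_lincomb R V2 _ (index_enum 'I_3) c F (0, 0) (fun i => (Fhol i).1).
  split=> //; apply/funext => v; rewrite E.
  have Flin i : 'd (F i) (0, 0) v = v.1 * 'd (F i) (0, 0) ((1, 0) : V2)
       + v.2 * 'd (F i) (0, 0) ((0, 1) : V2).
    exact: Clinear_pair (Fhol i).2.
  under eq_bigr do rewrite Flin mulrDr !(mulrCA (c _)).
  by rewrite big_split /= -!mulr_sumr ca cb !mulr0 addr0.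
have Gsmall e : 0 < e -> \forall v \near (0 : V2), cmod (G v) <= e * `|v|.
  move=> e0; have := diff_err dG.1 e0; apply: filterS => v; rewrite dG.2 subr0.
  have -> : G (0, 0) = 0.
    rewrite -phi0 -[phi _]/(Phi (0, 0)) GPhi//.
    rewrite big1// => i _; rewrite /P; case: eqP => _ /=; first by rewrite mulr0 mulr0.
    by case: eqP => _; rewrite expr0n mulr0.
  by rewrite subr0 addr0.
(* On the line through e the combination of invariants is d z^k, and the
   coordinates of Phi are O(|z|^k), so G o Phi is o(|z|^k). *)
have key (e : V2) (k : nat) (d : C) :
    (e.1 = 0 \/ e.2 = 0) /\ k = N \/ k = 2%N ->
    (forall z : C, \sum_i c i * P i (z * e.1, z * e.2) = d * z ^+ k) -> d = 0.
  move=> ek Pd.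
  have k0 : (0 < k)%N by case: ek => [[_ ->]|->].
  pose L (z : C) : V2 := (z * e.1, z * e.2).
  have LE z : L z = complex.Re z *: e + complex.Im z *: J2 e.
    by rewrite /L /J2; congr pair; rewrite /= cmulE.
  have Lc : continuous L.
    apply: (@lipschitz_cont R C V2 L (cmod e.1 + cmod e.2)) => z w.
    have -> : L z - L w = ((z - w) * e.1, (z - w) * e.2).
      by rewrite /L; congr pair; rewrite /= mulrBl.
    rewrite prod_normE /= ge_max !cnormM mulrC ler_wpM2r ?lerDl//=.
    by rewrite mulrC ler_wpM2r ?lerDr.
  have UL : \forall z \near (0 : C), U (piY (L z)).
    have UL0 : U (piY (L 0)) by rewrite /L !mul0r.
    exact: (Lc 0 [set y | U (piY y)] (nearU _ UL0)).
  have bound (g : V2 -> C) : (forall x, holomorphic_at J2 g x) -> g (0, 0) = 0 ->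
    exists2 K : R, 0 < K & \forall z \near (0 : C), cmod (g (Phi (L z))) <= K * cmod z ^+ k.
    move=> gh g0; pose h (z : C) := g (Phi (L z)).
    have [||K K0 H] := @invariant_bound R h k k0.
    - near=> z; have Uz : U (piY (L z)) by exact: (near UL z).
      rewrite /h (_ : (fun z => _) = (fun z : C => (fun x => g (Phi x)) (complex.Re z *: e + complex.Im z *: J2 e))); last first.
        by apply/funext => w; rewrite LE.
      have Hh := Phihol g gh (L z) Uz.
      by rewrite LE in Hh; exact: (cdiff_line Hh).
    - move=> z w zw; rewrite /h /Phi /L; congr (g (phi _)); exact: piY_root zw.
    have h0 : h 0 = 0 by rewrite /h /Phi /L !mul0r [phi _]phi0 g0.
    exists K => //; move: H; apply: (@filterS _ (nbhs (0 : C))) => z.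
    by rewrite h0 subr0.
  have [K1 K10 B1] := bound _ holomorphic_fst erefl.
  have [K2 K20 B2] := bound _ holomorphic_snd erefl.
  apply: (@eq0_small _ (K1 + K2)) => r r0.
  have /(@nbhs_normP R V2)[s /= s0 Hs] := Gsmall r r0.
  have [z [z0 Bz1 Bz2 Uz ss]] : exists z : C, [/\ z != 0,
     cmod (Phi (L z)).1 <= K1 * cmod z ^+ k, cmod (Phi (L z)).2 <= K2 * cmod z ^+ k,
     U (piY (L z)) & `|Phi (L z)| < s].
    have /near_cP[d1 d10 H1] := B1; have /near_cP[d2 d20 H2] := B2.
    have /near_cP[d3 d30 H3] := UL.
    pose d' := Num.min d1 (Num.min d2 d3).
    have d'0 : 0 < d' by rewrite !lt_min d10 d20.
    pose m := Num.min d' (Num.min 1 (s / (K1 + K2))).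
    have K12 : 0 < K1 + K2 by rewrite addr_gt0.
    have m0 : 0 < m by rewrite /m lt_min d'0 /= lt_min ltr01 divr_gt0.
    have md : m <= d' by rewrite ge_min lexx.
    have m1 : m <= 1 by rewrite !ge_min lexx orbT.
    have ms : m <= s / (K1 + K2) by rewrite !ge_min lexx !orbT.
    pose z : C := (m / 2) *: 1.
    have zm : cmod z = m / 2.
      by rewrite /z normrZ cnorm1 mulr1 ger0_norm// divr_ge0// ltW.
    have m2 : m / 2 < m by rewrite ltr_pdivrMr//; lra.
    have : cmod (z - 0) < d' by rewrite subr0 zm (lt_le_trans m2).
    rewrite !lt_min => /and3P[/H1 h1 /H2 h2 /H3 h3].
    have zk : cmod z ^+ k <= cmod z.
      by rewrite -[leRHS]expr1 ler_wiXn2l// zm ?divr_ge0 ?ltW// (lt_le_trans m2).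
    have zs : (K1 + K2) * cmod z < s.
      by rewrite mulrC -ltr_pdivlMr// zm (lt_le_trans m2).
    exists z; split=> //.
      by rewrite -normr_gt0 zm divr_gt0.
    rewrite prod_normE /= gt_max; apply/andP; split.
      rewrite (le_lt_trans h1)// (le_lt_trans _ zs)//.
      by rewrite (le_trans (ler_wpM2l (ltW K10) zk))// ler_wpM2r// lerDl ltW.
    rewrite (le_lt_trans h2)// (le_lt_trans _ zs)//.
    by rewrite (le_trans (ler_wpM2l (ltW K20) zk))// ler_wpM2r// lerDr ltW.
  have := Hs (Phi (L z)); rewrite /= sub0r normrN => /(_ ss).
  rewrite GPhi// Pd cnormM cnormX => H.
  have zk : 0 < cmod z ^+ k by rewrite exprn_gt0// normr_gt0.
  rewrite -(ler_pM2r zk) (le_trans H)// -mulrA ler_wpM2l ?(ltW r0)//.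
  rewrite prod_normE /= ge_max mulrDl; apply/andP; split.
    by rewrite (le_trans Bz1)// lerDl mulr_ge0 ?ltW.
  by rewrite (le_trans Bz2)// lerDr mulr_ge0 ?ltW.
have S3 x : \sum_i c i * P i x = c 0 * (x.1 * x.2) + c 1 * x.1 ^+ N + c 2 * x.2 ^+ N.
  by rewrite !big_ord_recl big_ord0 /P /= addr0 addrA; congr (_ + _ * _ + _ * _); congr c; apply/val_inj.
have c1 : c 1 = 0.
  apply: (@key (1, 0) N) => [|z]; first by left; split=> //; right.
  by rewrite S3 /= !mulr0 mulr1 add0r expr0n /= mulr0 addr0.
have c2 : c 2 = 0.
  apply: (@key (0, 1) N) => [|z]; first by left; split=> //; left.
  by rewrite S3 /= mulr0 mul0r mulr0 mulr1 add0r expr0n /= mulr0 add0r.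
have c00 : c 0 = 0.
  apply: (@key (1, 1) 2) => [|z]; first by right.
  by rewrite S3 /= c1 c2 !mul0r !addr0 !mulr1 expr2.
case: c0 => i /negP; apply; apply/eqP.
have : i \in [:: 0; 1; 2] by rewrite !inE -!val_eqE; case: (i) => -[|[|[|//]]].
by rewrite !inE => /or3P[] /eqP ->.
Unshelve. all: by end_near. Qed.

End Cyclic.

(** * Germs of quotients *)

Section Germs.
Variable R : realType.
Local Notation C := (Rcomplex R).

(** The values of a section outside U are arbitrary, so that restricting the
domain of a comparison has to be justified by this property. *)
Definition fs_local (X : fspace R) := forall (U : set X) (f g : X -> C),
  open U -> (forall x, U x -> f x = g x) -> fs_hol U f -> fs_hol U g.

Lemma flat_local (V : normedModType R) (J : V -> V) : fs_local (flat_space J).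
Proof.
move=> U f g oU fg hf x Ux; apply: holomorphic_near (hf x Ux).
by apply: (@filterS V (nbhs x) _ U) => //; exact: (@open_nbhs_nbhs V).
Qed.

Lemma orbit_local (X : fspace R) (G : transf_group X) :
  fs_local X -> fs_local (orbit_space G).
Proof.
move=> lX U f g oU fg; apply: lX => //.
by move=> x Ux; exact: fg.
Qed.

Lemma open_inv (X Y : topologicalType) (U : set X) (phi : X -> Y) (W : set Y) :
  open U -> open W -> (forall u, U u -> {for u, continuous phi}) ->
  open (U `&` phi @^-1` W).
Proof.
move=> oU oW cphi; rewrite openE => u [Uu Wu].
apply: filterI; first exact: open_nbhs_nbhs.
by apply: cphi => //; exact: open_nbhs_nbhs.
Qed.

Lemma germ_iso_join (X Y Z : fspace R) (x : X) (y : Y) (z : Z) : fs_local X ->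
  germ_iso x y -> germ_iso x z -> germ_iso y z.
Proof.
move=> lX [U [V [phi [psi [[oU oV Ux Vy phix] [hU hV K1 K2] [c1 c2] hol]]]]].
move=> [U' [V' [phi' [psi' [[oU' oV' Ux' Vz phix'] [hU' hV' K1' K2'] [c1' c2'] hol']]]]].
have psiy : psi y = x by rewrite -phix K1.
have psiz : psi' z = x by rewrite -phix' K1'.
exists (V `&` psi @^-1` U'), (V' `&` psi' @^-1` U), (phi' \o psi), (phi \o psi').
split.
- split; rewrite /= ?psiy ?psiz ?phix' //; try exact: open_inv.
- split.
  + by move=> v [Vv U'v] /=; split; [exact: hU'|rewrite /= K1'//; exact: hV].
  + by move=> v [Vv U'v] /=; split; [exact: hU|rewrite /= K1//; exact: hV'].
  + by move=> v [Vv U'v] /=; rewrite K1'// K2.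
  + by move=> v [Vv U'v] /=; rewrite K1// K2'.
- split.
  + move=> v [Vv U'v]; apply: continuous_comp; first exact: c2.
    exact: c1'.
  + move=> v [Vv U'v]; apply: continuous_comp; first exact: c2'.
    exact: c1.
move=> W f oW WV.
have WV' : W `<=` V' by move=> w /WV[].
pose W2 := (V `&` psi @^-1` U') `&` (phi' \o psi) @^-1` W.
have oW2 : open W2.
  apply: open_inv => //; first exact: open_inv.
  by move=> v [Vv U'v]; apply: continuous_comp; [exact: c2|exact: c1'].
have E : U `&` phi @^-1` W2 = U' `&` phi' @^-1` W.
  apply/seteqP; split=> u.
    by move=> [Uu [[_ /= U'u] /= Wu]]; rewrite K1// in U'u Wu.
  move=> [U'u Wu]; have [_ /=] := WV _ Wu; rewrite K1'// => Uu.
  by split=> //; split; [split|]; rewrite /= ?K1//; exact: hU.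
have oE : open (U' `&` phi' @^-1` W) by exact: open_inv.
have H1 := hol' W f oW WV'.
have H2 := hol W2 (f \o (phi' \o psi)) oW2 (fun w H => H.1.1).
rewrite -E in H1 oE.
split=> [/H1 h|/H2 h].
  apply/H2; apply: lX h => // u [Uu _] /=; by rewrite K1.
apply/H1; apply: lX h => // u [Uu _] /=; by rewrite K1.
Qed.

Lemma orbit_openP (X : fspace R) (G : transf_group X) (W : set (orbit_space G)) :
  open W <-> open (orbit_pi G @^-1` W).
Proof. by []. Qed.

Lemma orbit_holP (X : fspace R) (G : transf_group X) (W : set (orbit_space G))
    (f : orbit_space G -> C) :
  fs_hol W f <-> fs_hol (orbit_pi G @^-1` W) (fun x => f (orbit_pi G x)).
Proof. by []. Qed.

Section Cover.
Variables (V : normedModType R) (J : V -> V) (X : fspace R) (G : set (V -> V)).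

(** Holomorphy of g, in the form in which it acts on sections. *)
Definition holo_map (V' : normedModType R) (J' : V' -> V') (g : V -> V') :=
  continuous g /\ forall (f : V' -> C) (x : V),
    holomorphic_at J' f (g x) -> holomorphic_at J (fun y => f (g y)) x.

(** A quotient in one step by a group G, stated for a projection instead of
[orbit_space] because H/Γ is obtained in two steps, by the lattice and then by
the finite group. *)
Record quotient_map (pi : V -> X) := QuotientMap {
  qm_open : forall W : set X, open W <-> open (pi @^-1` W);
  qm_hol : forall (W : set X) (f : X -> C),
    fs_hol W f <-> forall x, W (pi x) -> holomorphic_at J (fun y => f (pi y)) x;
  qm_orbit : forall x y, pi x = pi y <-> exists2 g, G g & g x = y;
  qm_holo : forall g, G g -> holo_map J g }.

Variables (pi : V -> X) (qm : quotient_map pi).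

Lemma qm_image_open (O : set V) : open O -> open (pi @` O).
Proof.
move=> oO; apply/(qm_open qm); rewrite openE => x [b Ob bx].
have [g Gg gx] := (qm_orbit qm x b).1 (esym bx).
have [cg _] := qm_holo qm Gg.
have : nbhs x (g @^-1` O).
  by apply: cg; rewrite gx; apply: open_nbhs_nbhs.
apply: filterS => z Oz; exists (g z) => //; apply/esym/(qm_orbit qm).
by exists g.
Qed.

(** Holomorphy upstairs is tested at one point of a fibre, since the group acts
by holomorphic maps. *)
Lemma qm_fibre (F : X -> C) (x y : V) : pi x = pi y ->
  holomorphic_at J (fun z => F (pi z)) y -> holomorphic_at J (fun z => F (pi z)) x.
Proof.
move=> /(qm_orbit qm)[g Gg gx] H; have [_ hg] := qm_holo qm Gg.
rewrite -gx in H; have := hg _ _ H.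
rewrite (_ : (fun z => F (pi (g z))) = (fun z => F (pi z)))//.
by apply/funext => z; congr F; apply/esym/(qm_orbit qm); exists g.
Qed.

End Cover.

(** If a change of coordinates A matches, on the open set O, the identifications
made by p1 with those made by p2, then p1 x |-> p2 (A x) is well defined on the
image of O and is an isomorphism.  It is defined by choosing a preimage in O. *)
Lemma germ_iso_cover (V1 V2 : normedModType R) (J1 : V1 -> V1) (J2 : V2 -> V2)
  (X1 X2 : fspace R) (G1 : set (V1 -> V1)) (G2 : set (V2 -> V2))
  (p1 : V1 -> X1) (p2 : V2 -> X2) (A : V1 -> V2) (B : V2 -> V1) (O : set V1) (x0 : V1) :
  quotient_map J1 G1 p1 -> quotient_map J2 G2 p2 ->
  holo_map J1 J2 A -> holo_map J2 J1 B -> cancel A B -> cancel B A ->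
  open O -> O x0 ->
  (forall x y, O x -> O y -> p1 x = p1 y <-> p2 (A x) = p2 (A y)) ->
  germ_iso (p2 (A x0)) (p1 x0).
Proof.
move=> q1 q2 [cA hA] [cB hB] AK BK oO Ox0 OP.
pose phi u := p1 (xget x0 [set b | O b /\ p2 (A b) = u]).
pose psi v := p2 (A (xget x0 [set b | O b /\ p1 b = v])).
have phiE b : O b -> phi (p2 (A b)) = p1 b.
  move=> Ob; rewrite /phi; case: xgetP => [b' _ [Ob' /(OP _ _ Ob' Ob)]//|].
  by move=> /(_ b)[].
have psiE b : O b -> psi (p1 b) = p2 (A b).
  move=> Ob; rewrite /psi; case: xgetP => [b' _ [Ob' /(OP _ _ Ob' Ob)]//|].
  by move=> /(_ b)[].
have AO O' : open O' -> open (A @` O').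
  move=> oO'; rewrite (_ : A @` O' = B @^-1` O').
    by apply: open_comp => // ? _; exact: cB.
  apply/seteqP; split=> [_ [b Ob <-]|y Oy]; first by rewrite /= AK.
  by exists (B y).
pose U := p2 @` (A @` O); pose V := p1 @` O.
have oU : open U by apply: qm_image_open q2 _ _; exact: AO.
have oV : open V by exact: qm_image_open q1 _ _.
have cp1 : continuous p1.
  by apply/continuousP => W /(qm_open q1).
have cp2 : continuous p2.
  by apply/continuousP => W /(qm_open q2).
have cphi u : U u -> {for u, continuous phi}.
  move=> [_ [b Ob <-] <-] P; rewrite phiE// nbhsE => -[W [oW Wb] WP].
  have oI : open (p2 @` (A @` (O `&` p1 @^-1` W))).
    apply: qm_image_open q2 _ _; apply: AO; apply: openI => //.
    by apply/(qm_open q1).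
  apply: (@filterS _ _ _ (p2 @` (A @` (O `&` p1 @^-1` W)))).
    by move=> _ [_ [b' [Ob' Wb'] <-] <-]; apply: WP; rewrite /= phiE.
  by apply: open_nbhs_nbhs; split=> //; exists (A b) => //; exists b.
have cpsi v : V v -> {for v, continuous psi}.
  move=> [b Ob <-] P; rewrite psiE// nbhsE => -[W [oW Wb] WP].
  have oI : open (p1 @` (O `&` (p2 \o A) @^-1` W)).
    apply: qm_image_open q1 _ _; apply: openI => //.
    apply: open_comp => // x _; apply: continuous_comp; [exact: cA|exact: cp2].
  apply: (@filterS _ _ _ (p1 @` (O `&` (p2 \o A) @^-1` W))).
    by move=> _ [b' [Ob' Wb'] <-]; apply: WP; rewrite /= psiE.
  by apply: open_nbhs_nbhs; split=> //; exists b.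
exists U, V, phi, psi; split.
- by split=> //; [exists (A x0) => //; exists x0|exists x0|exact: phiE].
- split.
  + by move=> _ [_ [b Ob <-] <-]; rewrite phiE//; exists b.
  + by move=> _ [b Ob <-]; rewrite psiE//; exists (A b) => //; exists b.
  + by move=> _ [_ [b Ob <-] <-]; rewrite phiE// psiE.
  + by move=> _ [b Ob <-]; rewrite psiE// phiE.
- by [].
move=> W f oW WV; split=> [/(qm_hol q1) H|/(qm_hol q2) H].
  apply/(qm_hol q2) => y [[_ [b Ob <-] by_] /=]; rewrite -by_ phiE// => Wb.
  apply: (qm_fibre q2 (F := f \o phi) (esym by_)).
  apply: (@holomorphic_near _ _ _ (fun y => f (p1 (B y)))).
    apply: (@filterS _ _ _ (A @` O)).
      by move=> _ [b' Ob' <-] /=; rewrite AK phiE.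
    by apply: open_nbhs_nbhs; split; [exact: AO|exists b].
  by apply: (hB (fun x => f (p1 x))); rewrite AK; exact: H.
apply/(qm_hol q1) => x /[dup] Wx /WV[b Ob bx].
apply: (qm_fibre q1 (esym bx)).
apply: (@holomorphic_near _ _ _ (fun y => (f \o phi) (p2 (A y)))).
  apply: (@filterS _ _ _ O); last exact: open_nbhs_nbhs.
  by move=> b' Ob' /=; rewrite phiE.
apply: (hA (fun y => (f \o phi) (p2 y))); apply: H.
split; first by exists (A b) => //; exists b.
by rewrite /= phiE// bx.
Qed.

Lemma holo_affine (V W : normedModType R) (J : V -> V) (J' : W -> W)
  (L : {linear V -> W}) (c : W) : continuous L ->
  (forall v, L (J v) = J' (L v)) -> holo_map J J' (fun x => L x + c).
Proof.
move=> cL LJ; split.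
  by move=> x; apply: cvgD; [exact: cL|exact: cvg_cst].
move=> f x [df Jf].
have dA : differentiable (fun x => L x + c) x.
  by apply: differentiableD => //; exact: linear_differentiable.
have EA : 'd (fun x => L x + c) x = L :> (V -> W).
  rewrite (diffD (linear_differentiable x cL) (differentiable_cst c x)).
  apply/funext => v /=; rewrite (diff_lin x cL).
  by rewrite (diff_cst c x) addr0.
have E v : 'd (fun y => f (L y + c)) x v = 'd f (L x + c) (L v).
  by rewrite (@diff_comp R V W C (fun x => L x + c) f x dA df) /= EA.
split; first exact: (@differentiable_comp R V W C (fun x => L x + c) f x dA df).
by move=> v; rewrite !E LJ Jf.
Qed.

Lemma holo_bounded_affine (V W : normedModType R) (J : V -> V) (J' : W -> W)
  (L : V -> W) (c : W) (k : R) : linear L -> (forall v, `|L v| <= k * `|v|) ->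
  (forall v, L (J v) = J' (L v)) -> holo_map J J' (fun x => L x + c).
Proof.
move=> linL bL; pose LL : {linear V -> W} := HB.pack L (GRing.isLinear.Build _ _ _ _ L linL).
apply: (@holo_affine _ _ J J' LL c); apply: (@lipschitz_cont R V W L k) => x y.
by rewrite -[L x - L y](linearB LL) bL.
Qed.

End Germs.

(** * Eigenvectors of left multiplications *)

Section QuatAlg.
Variable R : realType.
Local Notation C := (Rcomplex R).
Local Notation H := (quat R).
Local Notation V2 := (C * C)%type.
Implicit Types x y z e m v : H.

Lemma qco_norm x l : `|qco x l| <= `|x|.
Proof.
rewrite /qco [leRHS]mx_normrE.
exact: (le_bigmax _ (fun ij : 'I_1 * 'I_4 => `|x ij.1 ij.2|) (ord0, inord l)).
Qed.

Lemma Quat_norm (a b c d k : R) : 0 <= k ->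
  `|a| <= k -> `|b| <= k -> `|c| <= k -> `|d| <= k -> `|Quat a b c d| <= k.
Proof.
move=> k0 ka kb kc kd; rewrite [leLHS]mx_normrE.
apply/bigmax_leP; split=> // -[i j] _ /=; rewrite mxE.
by case: j => -[|[|[|[|//]]]].
Qed.

Lemma qcoD x y l : qco (x + y) l = qco x l + qco y l.
Proof. by rewrite /qco mxE. Qed.

Lemma qcoZ (k : R) x l : qco (k *: x) l = k * qco x l.
Proof. by rewrite /qco mxE. Qed.

Lemma qmulDl x y z : qmul (x + y) z = qmul x z + qmul y z.
Proof.
by rewrite (quatE x) (quatE y) (quatE z) quatD !qmulE quatD; congr Quat; ring.
Qed.

Lemma qmulZl (k : R) x z : qmul (k *: x) z = k *: qmul x z.
Proof.
by rewrite (quatE x) (quatE z) quatZ !qmulE quatZ; congr Quat; ring.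
Qed.

Lemma qmulZr (k : R) x z : qmul z (k *: x) = k *: qmul z x.
Proof.
by rewrite (quatE x) (quatE z) quatZ !qmulE quatZ; congr Quat; ring.
Qed.

Lemma qmul_norm x y : `|qmul x y| <= 4 * `|x| * `|y|.
Proof.
rewrite /qmul; apply: Quat_norm; first by rewrite !mulr_ge0.
all: have hx := qco_norm x; have hy := qco_norm y;
  have P i j : `|qco x i * qco y j| <= `|x| * `|y| by rewrite normrM ler_pM.
all: rewrite (_ : 4 * `|x| * `|y| = `|x| * `|y| + `|x| * `|y| + `|x| * `|y| + `|x| * `|y|); last by ring.
all: by do 3 (apply: (le_trans (ler_normD _ _)); rewrite ?normrN; apply: lerD => //).
Qed.

Lemma qmulNl x z : qmul (- x) z = - qmul x z.
Proof. by rewrite -scaleN1r qmulZl scaleN1r. Qed.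
Lemma qmulNr x z : qmul z (- x) = - qmul z x.
Proof. by rewrite -scaleN1r qmulZr scaleN1r. Qed.
Lemma qmulBr x y z : qmul z (x - y) = qmul z x - qmul z y.
Proof. by rewrite qmulDr qmulNr. Qed.
Lemma qmul0r z : qmul z 0 = 0.
Proof. by rewrite -(scale0r 0) qmulZr !scale0r. Qed.
Lemma qmul1l x : qmul (q1 R) x = x.
Proof. by rewrite (quatE x) /q1 qmulE; congr Quat; ring. Qed.
Lemma qmul1r x : qmul x (q1 R) = x.
Proof. by rewrite (quatE x) /q1 qmulE; congr Quat; ring. Qed.

Definition qnorm2 x : R := qco x 0 ^+ 2 + qco x 1 ^+ 2 + qco x 2 ^+ 2 + qco x 3 ^+ 2.
Definition qinv x : H := (qnorm2 x)^-1 *: Quat (qco x 0) (- qco x 1) (- qco x 2) (- qco x 3).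

Lemma qnorm2_neq0 x : x != 0 -> qnorm2 x != 0.
Proof.
apply: contra => /eqP; rewrite /qnorm2 => h.
have := sqr_ge0 (qco x 0); have := sqr_ge0 (qco x 1).
have := sqr_ge0 (qco x 2); have := sqr_ge0 (qco x 3) => h3 h2 h1 h0.
have z a : 0 <= a ^+ 2 -> a ^+ 2 <= 0 -> a = 0 :> R.
  by move=> ? ?; apply/eqP; rewrite -sqrf_eq0 eq_le; apply/andP.
have q0 l : qco (0 : H) l = 0 by rewrite /qco mxE.
by apply/eqP; apply: quatP; rewrite q0; apply: z => //; lra.
Qed.

Lemma qmulV x : x != 0 -> qmul x (qinv x) = q1 R.
Proof.
move=> /qnorm2_neq0; rewrite /qinv /qnorm2.
rewrite [X in qmul X _](quatE x) quatZ qmulE /q1 => h.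
by congr Quat; field.
Qed.

Lemma qVmul x : x != 0 -> qmul (qinv x) x = q1 R.
Proof.
move=> /qnorm2_neq0; rewrite /qinv /qnorm2.
rewrite [X in qmul _ X](quatE x) quatZ qmulE /q1 => h.
by congr Quat; field.
Qed.

Lemma qmul_eq0 x y : x != 0 -> qmul x y = 0 -> y = 0.
Proof.
move=> x0 h; rewrite -(qmul1l y) -(qVmul x0) -qmulA h.
exact: qmul0r.
Qed.

Lemma Quat_inj (a b c d a' b' c' d' : R) : Quat a b c d = Quat a' b' c' d' ->
  [/\ a = a', b = b', c = c' & d = d'].
Proof.
move=> E; have [h0 h1 h2 h3] := qcoE a b c d.
by have [k0 k1 k2 k3] := qcoE a' b' c' d'; split; congruence.
Qed.

Lemma pure_unitP q : qmul q q = - q1 R ->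
  exists b c d : R, q = Quat 0 b c d /\ b ^+ 2 + c ^+ 2 + d ^+ 2 = 1.
Proof.
rewrite (quatE q); move: (qco q 0) (qco q 1) (qco q 2) (qco q 3) => a b c d.
rewrite qmulE /q1 quatN => /Quat_inj[h0 h1 h2 h3].
have a0 : a = 0.
  apply/eqP; apply/negPn/negP => a0.
  have z u : a * u = 0 -> u = 0 by move=> /eqP; rewrite mulf_eq0 (negbTE a0) => /eqP.
  have b0 : b = 0 by apply: z; lra.
  have c0 : c = 0 by apply: z; lra.
  have d0 : d = 0 by apply: z; lra.
  by have := sqr_ge0 a; move: h0; rewrite b0 c0 d0; lra.
by exists b, c, d; split; [rewrite a0|move: h0; rewrite a0; lra].
Qed.

Lemma qco0 (a b c d : R) : qco (Quat a b c d) 0 = a.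
Proof. by have [] := qcoE a b c d. Qed.

(** One has v (1 - v q) = v + q = (1 - v q) q.  If 1 - v q = 0, then q = -v, and
v e = e q says that the imaginary quaternion e is orthogonal to v. *)
Lemma pure_units_conj v q : qmul v v = - q1 R -> qmul q q = - q1 R ->
  exists2 e, e != 0 & qmul v e = qmul e q.
Proof.
move=> vv qq.
have [E|N] := eqVneq (q1 R - qmul v q) 0; last first.
  exists (q1 R - qmul v q) => //.
  rewrite qmulBr qmul1r qmulA vv qmulDl qmul1l !qmulNl -qmulA qq qmulNr.
  by rewrite !opprK qmul1l qmul1r addrC.
have vq : q = - v.
  have : qmul v q = q1 R by apply/esym/eqP; rewrite -subr_eq0 E.
  move=> /(congr1 (qmul v)); rewrite qmulA vv qmulNl qmul1l qmul1r => <-.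
  by rewrite opprK.
have [b [c [d [vE s1]]]] := pure_unitP vv.
have W (a1 a2 a3 : R) : b * a1 + c * a2 + d * a3 = 0 ->
    qmul v (Quat 0 a1 a2 a3) = qmul (Quat 0 a1 a2 a3) q.
  move=> h; rewrite vq vE quatN !qmulE; congr Quat; lra.
have [b0|b0] := eqVneq b 0.
  exists (Quat 0 1 0 0); last by apply: W; lra.
  by apply/eqP => /rowP/(_ 1) /eqP; rewrite !mxE /= oner_eq0.
exists (Quat 0 c (- b) 0); last by apply: W; lra.
by apply/eqP => /rowP/(_ 2) /eqP; rewrite !mxE /= oppr_eq0 (negbTE b0).
Qed.

Section Eigen.
Variables (q v e1 e2 : H).
Hypothesis qq : qmul q q = - q1 R.
Hypotheses (e10 : e1 != 0) (e20 : e2 != 0).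
Hypotheses (ve1 : qmul v e1 = qmul e1 q) (ve2 : qmul (- v) e2 = qmul e2 q).

(** The isomorphism of C with R[q]. *)
Definition cembed (z : C) : H := complex.Re z *: q1 R + complex.Im z *: q.

(** The component in R[q] of m, along the quaternions that anticommute
with q. *)
Definition qproj (m : H) : C := (qco m 0 +i* - qco (qmul m q) 0)%C.

Lemma cembed_mul (z w : C) : cembed (z * w) = qmul (cembed z) (cembed w).
Proof.
case: z w => [a b] [c d]; rewrite /cembed /=.
rewrite !(qmulDl, qmulDr, qmulZl, qmulZr) qq !qmul1l !qmul1r.
by move: q => u; apply/rowP => i; rewrite !mxE; ring.
Qed.

Lemma cembed_i (z : C) : cembed (('i%C : C) * z) = qmul (cembed z) q.
Proof.
rewrite mulrC cembed_mul; congr qmul.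
by rewrite /cembed /= scale0r add0r scale1r.
Qed.

Lemma cembed_qproj m : cembed (qproj m) = 2^-1 *: (m - qmul q (qmul m q)).
Proof.
have [b [c [d [qE s1]]]] := pure_unitP qq.
rewrite /cembed /qproj /= (quatE m) qE.
move: (qco m 0) (qco m 1) (qco m 2) (qco m 3) => m0 m1 m2 m3.
rewrite !qmulE /q1 !qco0 !(quatN, quatD, quatZ); congr Quat.
- by have := congr1 ( *%R m0) s1; lra.
- by have := congr1 ( *%R m1) s1; lra.
- by have := congr1 ( *%R m2) s1; lra.
- by have := congr1 ( *%R m3) s1; lra.
Qed.

(** Complex coordinates on H, with multiplication by q on the right as complex
structure, in the basis of eigenvectors e1, e2 of the left multiplication
by v. *)
Definition chart (p : V2) : H := qmul e1 (cembed p.1) + qmul e2 (cembed p.2).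
Definition chart_inv (x : H) : V2 := (qproj (qmul (qinv e1) x), qproj (qmul (qinv e2) x)).

Lemma chartJ p : chart (('i%C : C) * p.1, ('i%C : C) * p.2) = qmul (chart p) q.
Proof. by rewrite /chart /= !cembed_i qmulDl !qmulA. Qed.

(** With w = v or w = -v, the right-hand sides are the two projections of x onto
the eigenspaces of v; they add up to x. *)
Lemma eigen_part e w x : e != 0 -> qmul w e = qmul e q ->
  qmul e (cembed (qproj (qmul (qinv e) x))) = 2^-1 *: (x - qmul w (qmul x q)).
Proof.
move=> e0 we; rewrite cembed_qproj qmulZr qmulBr.
have E : qmul e (qmul (qinv e) x) = x by rewrite qmulA qmulV// qmul1l.
by rewrite E (qmulA e q) -we -(qmulA w e) (qmulA e _ q) E.
Qed.

Lemma chart_invK : cancel chart_inv chart.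
Proof.
move=> x; rewrite /chart /chart_inv /= (eigen_part x e10 ve1) (eigen_part x e20 ve2).
rewrite qmulNl; move: (qmul v _) => u.
by apply/rowP => i; rewrite !mxE; field.
Qed.

Lemma cembed_linear : linear cembed.
Proof.
move=> k [a b] [c d]; rewrite /cembed /=; move: q => u.
by apply/rowP => i; rewrite !mxE; ring.
Qed.

Lemma chart_linear : linear chart.
Proof.
move=> k p r; rewrite /chart /= !cembed_linear.
rewrite (qmulDr e1 (k *: _)) (qmulDr e2 (k *: _)) !qmulZr.
move: (qmul e1 (cembed p.1)) (qmul e1 (cembed r.1)) => u1 u2.
move: (qmul e2 (cembed p.2)) (qmul e2 (cembed r.2)) => u3 u4.
by apply/rowP => i; rewrite !mxE; ring.
Qed.

Lemma cembed_eq0 (z : C) : cembed z = 0 -> z = 0.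
Proof.
move=> z0; apply/eqP/negPn/negP => nz.
have := cembed_mul z^-1 z; rewrite mulVf// z0 qmul0r /cembed /= scale1r scale0r addr0.
by move/rowP/(_ 0)/eqP; rewrite !mxE /= oner_eq0.
Qed.

Lemma cembed_comm (z : C) : qmul q (cembed z) = qmul (cembed z) q.
Proof.
rewrite -cembed_i cembed_mul; congr qmul.
by rewrite /cembed /= scale0r add0r scale1r.
Qed.

(** The two eigenspaces of v meet in 0. *)
Lemma chart_eq0 p : chart p = 0 -> p = 0.
Proof.
case: p => z w; rewrite /chart /= => h.
set y := qmul e1 (cembed z) in h.
have yE : qmul e2 (cembed w) = - y by apply/eqP; rewrite -addr_eq0 addrC h.
have h1 : qmul v y = qmul y q.
  by rewrite /y qmulA ve1 -!qmulA cembed_comm.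
have h2 : qmul v y = - qmul y q.
  rewrite -qmulNl -yE -qmulA -cembed_comm (qmulA e2) -ve2 -qmulA yE.
  by rewrite qmulNl qmulNr opprK.
have y0 : y = 0.
  have h3 : qmul y q = 0.
    have : qmul y q = - qmul y q by rewrite -{1}h1 h2.
    by move=> /rowP hr; apply/rowP => i; move: (hr i); rewrite !mxE; lra.
  have := congr1 (fun u => qmul u q) h3; rewrite -qmulA qq qmulNr qmul1r.
  have -> : qmul (0 : H) q = 0 by rewrite -(scale0r 0) qmulZl !scale0r.
  by move=> /eqP; rewrite oppr_eq0 => /eqP.
congr pair; apply: cembed_eq0; first exact: (qmul_eq0 e10 y0).
by apply: (qmul_eq0 e20); rewrite yE y0 oppr0.
Qed.

Lemma chartK : cancel chart chart_inv.
Proof.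
move=> p; apply/eqP; rewrite -subr_eq0; apply/eqP/chart_eq0.
have -> : chart_inv (chart p) - p = (-1) *: p + chart_inv (chart p) by rewrite scaleN1r addrC.
by rewrite chart_linear scaleN1r chart_invK addNr.
Qed.

Lemma chart_norm : exists k : R, forall p, `|chart p| <= k * `|p|.
Proof.
have cn (z : C) : `|cembed z| <= (`|q1 R| + `|q|) * `|z|.
  rewrite (le_trans (ler_normD _ _))// !normrZ mulrDl lerD// mulrC ler_wpM2l//.
    exact: cnorm_Re.
  exact: cnorm_Im.
exists (4 * `|e1| * (`|q1 R| + `|q|) + 4 * `|e2| * (`|q1 R| + `|q|)) => -[z w].
rewrite (le_trans (ler_normD _ _))// mulrDl lerD// (le_trans (qmul_norm _ _))//.
  rewrite -[leRHS]mulrA ler_wpM2l ?mulr_ge0// (le_trans (cn _))//.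
  by rewrite ler_wpM2l ?addr_ge0// prod_normE /= le_max lexx.
rewrite -[leRHS]mulrA ler_wpM2l ?mulr_ge0// (le_trans (cn _))//.
by rewrite ler_wpM2l ?addr_ge0// prod_normE /= le_max lexx orbT.
Qed.

Lemma qproj_linear : linear qproj.
Proof.
move=> k x y; rewrite /qproj !(qmulDl, qmulZl, qcoD, qcoZ).
by apply/eqP; rewrite eq_complex /=; apply/andP; split; apply/eqP; ring.
Qed.

Lemma chart_inv_linear : linear chart_inv.
Proof.
by move=> k x y; rewrite /chart_inv !qmulDr !qmulZr !qproj_linear.
Qed.

Lemma chart_inv_norm : exists k : R, forall x, `|chart_inv x| <= k * `|x|.
Proof.
have cn x : `|qproj x : C| <= (1 + 4 * `|q|) * `|x|.
  rewrite (le_trans (cnorm_le _))//= normrN mulrDl mul1r lerD ?qco_norm//.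
  by rewrite (le_trans (qco_norm _ _))// (le_trans (qmul_norm _ _))// mulrAC.
pose k e := (1 + 4 * `|q|) * (4 * `|qinv e|) : R.
have k0 e : 0 <= k e by rewrite /k !mulr_ge0// addr_ge0// mulr_ge0.
have h e x : `|qproj (qmul (qinv e) x) : C| <= k e * `|x|.
  rewrite (le_trans (cn _))// /k -mulrA; apply: ler_wpM2l; last exact: qmul_norm.
  by rewrite addr_ge0// mulr_ge0.
exists (k e1 + k e2) => x; rewrite prod_normE /= ge_max mulrDl.
by rewrite !(le_trans (h _ _))//= ?lerDl ?lerDr mulr_ge0.
Qed.

Lemma chart_invJ x :
  chart_inv (qmul x q) = (('i%C : C) * (chart_inv x).1, ('i%C : C) * (chart_inv x).2).
Proof. by apply: (can_inj chartK); rewrite chartJ !chart_invK. Qed.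

End Eigen.

End QuatAlg.

(** * The group of lifts and its action on the quaternions *)

(** Coordinates of quaternions multiplied by 4.  The points with nontrivial
stabilizer and the translation parts of the group lie in Λ/2, a subset of
1/4 Z^4, so that the classification of the stabilizers is a computation with
integers. *)
Definition int4 : Type := (int * int * int * int)%type.
Definition zmul (u v : int4) : int4 :=
  let: (a, b, c, d) := u in let: (a', b', c', d') := v in
  (a * a' - b * b' - c * c' - d * d', a * b' + b * a' + c * d' - d * c',
   a * c' - b * d' + c * a' + d * b', a * d' + b * c' - c * b' + d * a').
Definition zadd (u v : int4) : int4 :=
  let: (a, b, c, d) := u in let: (a', b', c', d') := v in
  (a + a', b + b', c + c', d + d').
Definition zopp (u : int4) : int4 :=
  let: (a, b, c, d) := u in (- a, - b, - c, - d).
Definition zsub (u v : int4) : int4 := zadd u (zopp v).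
Definition quarter_hurwitz (w : int4) : bool :=
  let: (a, b, c, d) := w in
  [&& (4 %| a - d)%Z, (4 %| b - d)%Z, (4 %| c - d)%Z & (2 %| d)%Z].

Definition z1 : int4 := (1, 0, 0, 0).
Definition zi : int4 := (0, 1, 0, 0).
Definition zj : int4 := (0, 0, 1, 0).
Definition zk : int4 := (0, 0, 0, 1).

(** The pairs (u, 4 c) for lifts x |-> u x + c of the eight automorphisms. *)
Definition Q8lifts : seq (int4 * int4) :=
  let z := (0, 0, 0, 0) in let a := (2, 2, 0, 0) in
  [:: (z1, z); (zopp z1, z); (zi, z); (zopp zi, z);
      (zj, a); (zopp zj, zopp a); (zk, a); (zopp zk, zopp a)].

Definition lift_act4 (e : int4 * int4) (w : int4) : int4 := zadd (zmul e.1 w) e.2.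

Section Gamma.
Variable R : realType.
Local Notation C := (Rcomplex R).
Local Notation H := (quat R).
Local Notation V2 := (C * C)%type.
Implicit Types (u w : int4) (x y : H).

Definition qint u : H :=
  let: (a, b, c, d) := u in Quat a%:~R b%:~R c%:~R d%:~R.
Definition quarter w : H :=
  let: (a, b, c, d) := w in Quat (a%:~R / 4) (b%:~R / 4) (c%:~R / 4) (d%:~R / 4).
Definition lift_act (e : int4 * int4) x : H := qmul (qint e.1) x + quarter e.2.

Lemma quarter_add u w : quarter (zadd u w) = quarter u + quarter w.
Proof.
case: u w => [[[a b] c] d] [[[a' b'] c'] d'].
by rewrite /quarter /zadd quatD; congr Quat; rewrite intrD mulrDl.
Qed.

Lemma quarter_opp w : quarter (zopp w) = - quarter w.
Proof.
case: w => [[[a b] c] d].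
by rewrite /quarter /zopp quatN; congr Quat; rewrite intrN mulNr.
Qed.

Lemma quarter_sub u w : quarter (zsub u w) = quarter u - quarter w.
Proof. by rewrite quarter_add quarter_opp. Qed.

Lemma quarter_mul u w : quarter (zmul u w) = qmul (qint u) (quarter w).
Proof.
case: u w => [[[a b] c] d] [[[a' b'] c'] d'].
by rewrite /quarter /qint /zmul qmulE !(intrD, intrM, intrN); congr Quat; field.
Qed.

Lemma qint_mul u w : qint (zmul u w) = qmul (qint u) (qint w).
Proof.
case: u w => [[[a b] c] d] [[[a' b'] c'] d'].
by rewrite /qint /zmul qmulE !(intrD, intrM, intrN); congr Quat; ring.
Qed.

Lemma qint_opp w : qint (zopp w) = - qint w.
Proof.
by case: w => [[[a b] c] d]; rewrite /qint /zopp quatN !intrN.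
Qed.

Lemma lift_actE u c x : lift_act (u, c) x = qmul (qint u) x + quarter c.
Proof. by []. Qed.

Lemma lift_act_quarter e w : lift_act e (quarter w) = quarter (lift_act4 e w).
Proof. by rewrite /lift_act /lift_act4 quarter_add quarter_mul. Qed.

Lemma quarter_hurwitzP w : hurwitz (quarter w) <-> quarter_hurwitz w.
Proof.
case: w => [[[a b] c] d]; rewrite /quarter /quarter_hurwitz; split.
  move=> /hurwitzP[a' [b' [c' [d' /Quat_inj[ha hb hc hd]]]]].
  have inj (m n : int) : m%:~R / 4 = n%:~R / 2 :> R -> m = n * 2.
    move=> h; apply/eqP; rewrite -(eqr_int R) intrM; apply/eqP; lra.
  have inj4 (m n k : int) : m%:~R / 4 = n%:~R + k%:~R / 2 :> R -> m = n * 4 + k * 2.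
    move=> h; apply/eqP; rewrite -(eqr_int R) intrD !intrM; apply/eqP; lra.
  rewrite (inj _ _ hd) (inj4 _ _ _ ha) (inj4 _ _ _ hb) (inj4 _ _ _ hc).
  by rewrite !addrK !dvdz_mull.
move=> /and4P[/dvdzP[a' ha] /dvdzP[b' hb] /dvdzP[c' hc] /dvdzP[d' hd]].
apply/hurwitzP; exists a', b', c', d'.
have -> : a = a' * 4 + d by rewrite -ha subrK.
have -> : b = b' * 4 + d by rewrite -hb subrK.
have -> : c = c' * 4 + d by rewrite -hc subrK.
by rewrite hd !intrD !intrM; congr Quat; field.
Qed.

Lemma qint_hurwitz u (l : H) : hurwitz l -> hurwitz (qmul (qint u) l).
Proof.
case: u => [[[u0 u1] u2] u3] /hurwitzP[a [b [c [d ->]]]]; apply/hurwitzP.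
exists (u0 * a - u1 * (b + c + d) - u2 * (c - b) - u3 * (a + d)),
  (u0 * b + u1 * (a - c) + u2 * (b + d) - u3 * (a + c + d)),
  (u0 * c - u1 * (c + d) + u2 * (a + b + d) + u3 * (b - a)),
  (u0 * d + u1 * (c * 2 + d) - u2 * (b * 2 + d) + u3 * (a * 2 + d)).
by rewrite qmulE !(intrD, intrM, intrN); congr Quat; field.
Qed.

Variable q : H.
Local Notation X := (orbit_space (Q8hat q)).
Local Notation pi := (orbit_pi (lattice q)).
Definition quot_pi (x : H) : X := orbit_pi (Q8hat q) (pi x).

Lemma torus_pi_eq (x y : H) : pi x = pi y <-> hurwitz (y - x).
Proof.
split; last exact: torus_piP.
by move=> /orbit_piP[g [l Hl ->] <-]; rewrite addrC addKr.
Qed.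

Lemma aff_qint u (r x : H) : aff (qint u) (pi r) (pi x) = pi (qmul (qint u) x + r).
Proof. by apply: affE => l; exact: qint_hurwitz. Qed.

Lemma Q8hat_cases :
  (forall g, tg_set (Q8hat q) g -> exists2 e, e \in Q8lifts &
     forall x : H, g (pi x) = pi (lift_act e x)) /\
  (forall e, e \in Q8lifts -> exists2 g, tg_set (Q8hat q) g &
     forall x : H, g (pi x) = pi (lift_act e x)).
Proof.
have Ez1 : - q1 R = qint (zopp z1) by rewrite qint_opp.
have quarter0 : quarter (0, 0, 0, 0) = 0.
  by apply/rowP => -[[|[|[|[|//]]]] ?]; rewrite !mxE /= mul0r.
have quarter_alpha : quarter (2, 2, 0, 0) = qalpha R.
  by rewrite /qalpha /q1 /qi quatD quatZ /=; congr Quat; field.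
pose m1 := aff (- q1 R) (pi 0).
have m1E x : m1 (pi x) = pi (- x).
  by rewrite /m1 Ez1 aff_qint addr0 qint_opp qmulNl [qint z1](_ : _ = q1 R)// qmul1l.
have E1 x : pi x = pi (lift_act (z1, (0, 0, 0, 0)) x).
  by rewrite lift_actE quarter0 addr0 [qint z1](_ : _ = q1 R)// qmul1l.
have E u c (f : torus q -> torus q) : (forall x, f (pi x) = pi (lift_act (u, c) x)) ->
    forall x, (m1 \o f) (pi x) = pi (lift_act (zopp u, zopp c) x).
  by move=> fE x; rewrite -[(m1 \o f) _]/(m1 (f _)) fE m1E !lift_actE opprD qint_opp qmulNl quarter_opp.
have Em x : m1 (pi x) = pi (lift_act (zopp z1, (0, 0, 0, 0)) x).
  by rewrite m1E lift_actE quarter0 addr0 -Ez1 qmulNl qmul1l.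
have Ei x : aff (qi R) (pi 0) (pi x) = pi (lift_act (zi, (0, 0, 0, 0)) x).
  by rewrite (aff_qint zi) lift_actE quarter0.
have Ej x : aff (qj R) (pi (qalpha R)) (pi x) = pi (lift_act (zj, (2, 2, 0, 0)) x).
  by rewrite (aff_qint zj) lift_actE quarter_alpha.
have Ek x : aff (qk R) (pi (qalpha R)) (pi x) = pi (lift_act (zk, (2, 2, 0, 0)) x).
  by rewrite (aff_qint zk) lift_actE quarter_alpha.
have Emi := E _ _ _ Ei; have Emj := E _ _ _ Ej; have Emk := E _ _ _ Ek.
rewrite (_ : zopp (0, 0, 0, 0) = (0, 0, 0, 0)) in Emi; last by [].
split.
  move=> g /=; rewrite /Q8hat_set /= => -[[[[[[[->|->]|->]|->]|->]|->]|->]|->].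
  - by exists (z1, (0, 0, 0, 0)).
  - by exists (zopp z1, (0, 0, 0, 0)).
  - by exists (zi, (0, 0, 0, 0)).
  - by exists (zopp zi, (0, 0, 0, 0)).
  - by exists (zj, (2, 2, 0, 0)).
  - by exists (zopp zj, zopp (2, 2, 0, 0)).
  - by exists (zk, (2, 2, 0, 0)).
  - by exists (zopp zk, zopp (2, 2, 0, 0)).
move=> e; rewrite !inE.
case/orP=> [/eqP->|]; first by exists id => //=; rewrite /Q8hat_set /=; tauto.
case/orP=> [/eqP->|]; first by exists m1 => //=; rewrite /Q8hat_set /=; tauto.
case/orP=> [/eqP->|]; first by exists (aff (qi R) (pi 0)) => //=; rewrite /Q8hat_set /=; tauto.
case/orP=> [/eqP->|]; first by exists (m1 \o aff (qi R) (pi 0)) => //=; rewrite /Q8hat_set /=; tauto.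
case/orP=> [/eqP->|]; first by exists (aff (qj R) (pi (qalpha R))) => //=; rewrite /Q8hat_set /=; tauto.
case/orP=> [/eqP->|]; first by exists (m1 \o aff (qj R) (pi (qalpha R))) => //=; rewrite /Q8hat_set /=; tauto.
case/orP=> [/eqP->|/eqP->]; first by exists (aff (qk R) (pi (qalpha R))) => //=; rewrite /Q8hat_set /=; tauto.
by exists (m1 \o aff (qk R) (pi (qalpha R))) => //=; rewrite /Q8hat_set /=; tauto.
Qed.

(** The group Γ, listed by cosets of the lattice. *)
Definition deck : set (H -> H) :=
  [set g | exists e (l : H), [/\ e \in Q8lifts, hurwitz l & g = fun x => lift_act e x + l]].

Lemma quot_pi_eq (x y : H) : quot_pi x = quot_pi y <->
  exists2 e, e \in Q8lifts & hurwitz (y - lift_act e x).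
Proof.
have [Q1 Q2] := Q8hat_cases; split.
  move=> /orbit_piP[g /Q1[e eu gE] gx]; exists e => //.
  by apply/torus_pi_eq; rewrite -gE gx.
move=> [e /Q2[g Gg gE] h]; apply/orbit_piP; exists g => //.
by rewrite gE; apply/torus_pi_eq.
Qed.

Lemma quotient_map_quot_pi : quotient_map (fun x : H => qmul x q) deck quot_pi.
Proof.
apply: QuotientMap.
- by move=> W; apply: (iff_trans (orbit_openP W)); exact: (orbit_openP (orbit_pi (Q8hat q) @^-1` W)).
- move=> W f; apply: (iff_trans (orbit_holP W f)).
  by split=> h x Wx; exact: (h x Wx).
-  move=> x y; split.
    move=> /quot_pi_eq[e eu h]; exists (fun z => lift_act e z + (y - lift_act e x)); last by rewrite addrC subrK.
    by exists e, (y - lift_act e x).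
  move=> [_ [e [l [eu hl ->]]] <-]; apply/quot_pi_eq; exists e => //.
  by rewrite addrC addKr.
move=> _ [e [l [eu hl ->]]]; rewrite /lift_act.
have -> : (fun x => qmul (qint e.1) x + quarter e.2 + l) = (fun x => qmul (qint e.1) x + (quarter e.2 + l)).
  by apply/funext => x; apply/rowP => i; rewrite !mxE addrA.
apply: (@holo_bounded_affine _ _ _ _ _ (qmul (qint e.1)) _ (4 * `|qint e.1|)).
- by move=> k x y; rewrite qmulDr qmulZr.
- by move=> x; exact: qmul_norm.
- by move=> x; rewrite qmulA.
Qed.

Lemma hurwitz_small (l : H) : hurwitz l -> `|l| < 1 / 2 -> l = 0.
Proof.
move=> /hurwitzP[a [b [c [d ->]]]] hl.
have [h0 h1 h2 h3] := qcoE (a%:~R + d%:~R / 2 : R) (b%:~R + d%:~R / 2)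
  (c%:~R + d%:~R / 2) (d%:~R / 2).
have hq i := le_lt_trans (qco_norm _ i) hl.
have small (n : int) : `|n%:~R : R| < 1 -> n = 0.
  have [->//|n0] := eqVneq n 0.
  by rewrite ltNge norm_intr_ge1 ?intr_eq0// intr_int.
have d0 : d = 0.
  apply: small; have := hq 3; rewrite h3 normrM normfV [`|2|]ger0_norm//; lra.
have z (n : int) : `|n%:~R + d%:~R / 2 : R| < 1 / 2 -> n = 0.
  by rewrite d0 mul0r addr0 => h; apply: small; lra.
have a0 : a = 0 by apply: z; have := hq 0; rewrite h0.
have b0 : b = 0 by apply: z; have := hq 1; rewrite h1.
have c0 : c = 0 by apply: z; have := hq 2; rewrite h2.
rewrite a0 b0 c0 d0; apply/rowP => -[[|[|[|[|//]]]] ?]; rewrite !mxE /=; lra.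
Qed.

(** Two elements of d + Λ at distance less than 1/4 from 0 differ by an element
of Λ of norm less than 1/2, so at most one exists. *)
Lemma lattice_discrete (d : H) : exists2 r : R, 0 < r &
  forall l : H, hurwitz l -> `|d + l| < r -> d + l = 0.
Proof.
have [[l0 [hl0 n0 l0s]]|N] := pselect (exists l, [/\ hurwitz l, d + l != 0 & `|d + l| < 1 / 4]).
  exists `|d + l0|; first by rewrite normr_gt0.
  move=> l hl lr; suff E : l - l0 = 0.
    by move: lr; have -> : l = l0 by [apply/eqP; rewrite -subr_eq0 E]; rewrite ltxx.
  apply: hurwitz_small; first by apply: hurwitzD => //; exact: hurwitzN.
  have -> : l - l0 = (d + l) - (d + l0) by rewrite opprD addrACA subrr add0r.
  by rewrite (le_lt_trans (ler_normB _ _))//; lra.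
exists (1 / 4); first by lra.
move=> l hl lr; apply/eqP/negPn/negP => n0; apply: N; exists l; split=> //.
Qed.

Lemma finite_radius (T : eqType) (P : T -> R -> Prop) (s : seq T) :
  (forall e (r r' : R), 0 < r' -> r' <= r -> P e r -> P e r') ->
  (forall e, e \in s -> exists2 r : R, 0 < r & P e r) ->
  exists2 r : R, 0 < r & forall e, e \in s -> P e r.
Proof.
move=> mono; elim: s => [|a s IH] h; first by exists 1.
have [r1 r10 P1] := h a (mem_head _ _).
have [|r2 r20 P2] := IH; first by move=> e es; apply: h; rewrite inE es orbT.
have r0 : 0 < Num.min r1 r2 by rewrite lt_min r10.
exists (Num.min r1 r2) => // e; rewrite inE => /orP[/eqP ->|es].
  by apply: mono P1 => //; rewrite ge_min lexx.
by apply: mono (P2 _ es) => //; rewrite ge_min lexx orbT.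
Qed.

(** If an element of Γ maps a point near x0 to a point near x0, it displaces x0
by a small vector; the displacements of x0 by a coset of Λ form a discrete set,
and there are eight cosets. *)
Lemma deck_discontinuous (x0 : H) : exists2 r : R, 0 < r & forall e, e \in Q8lifts ->
  forall x y l : H, hurwitz l -> `|x - x0| < r -> `|y - x0| < r ->
    lift_act e x + l = y -> lift_act e x0 + l = x0.
Proof.
apply: finite_radius.
  by move=> e r r' r0 rr' h x y l hl xr yr; apply: h => //; exact: lt_le_trans rr'.
move=> e _; have [r r0 rP] := lattice_discrete (lift_act e x0 - x0).
pose k := 4 * `|qint e.1| + 1.
have k0 : 0 < k by rewrite ltr_wpDl// mulr_ge0.
exists (r / k); first by rewrite divr_gt0.
move=> x y l hl xr yr exy.
have E : lift_act e x0 - x0 + l = - qmul (qint e.1) (x - x0) + (y - x0).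
  rewrite -exy /lift_act qmulDr qmulNr; move: (qmul _ x) (qmul _ x0) => a b.
  by apply/rowP => i; rewrite !mxE; ring.
have : lift_act e x0 - x0 + l = 0.
  apply: rP => //; rewrite E (le_lt_trans (ler_normD _ _))// normrN.
  have rE : r = 4 * `|qint e.1| * (r / k) + r / k.
    by rewrite -[X in _ + X]mul1r -mulrDl mulrC divfK// gt_eqF.
  rewrite [ltRHS]rE ler_ltD// (le_trans (qmul_norm _ _))// ler_wpM2l ?mulr_ge0//.
  exact: ltW.
by rewrite addrAC => /eqP; rewrite subr_eq0 => /eqP.
Qed.

Section LocalModel.
Hypothesis qq : qmul q q = - q1 R.
Variables (v e1 e2 : H).
Hypotheses (e10 : e1 != 0) (e20 : e2 != 0).
Hypotheses (ve1 : qmul v e1 = qmul e1 q) (ve2 : qmul (- v) e2 = qmul e2 q).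
Let J2 (p : V2) : V2 := (('i%C : C) * p.1, ('i%C : C) * p.2).
Local Notation L := (chart q e1 e2).

(** Near x0 two points are identified exactly when an element of the stabilizer
of x0 does it.  This element is x |-> x0 + u (x - x0) for one of the eight units
u.  In the coordinates centred at x0 given by eigenvectors, the group G1 on C^2
has to be the group of these units. *)
Lemma local_model (Y : fspace R) (p1 : V2 -> Y) (G1 : set (V2 -> V2)) (x0 : H) :
  quotient_map J2 G1 p1 ->
  (forall e, e \in Q8lifts -> hurwitz (x0 - lift_act e x0) ->
     exists2 g, G1 g & forall p, L (g p) = qmul (qint e.1) (L p)) ->
  (forall g, G1 g -> exists e, [/\ e \in Q8lifts, hurwitz (x0 - lift_act e x0) &
     forall p, L (g p) = qmul (qint e.1) (L p)]) ->
  germ_iso (quot_pi x0) (p1 0).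
Proof.
move=> qm1 H1 H2.
have [r r0 rP] := deck_discontinuous x0.
have LK := chartK qq e10 e20 ve1 ve2; have BK := chart_invK qq e10 e20 ve1 ve2.
have [kL kLP] := chart_norm q e1 e2; have [kB kBP] := chart_inv_norm q e1 e2.
have linL := chart_linear q e1 e2; have linB := chart_inv_linear q e1 e2.
pose A p := L p + x0; pose B x := chart_inv q e1 e2 x + - chart_inv q e1 e2 x0.
have hA : holo_map J2 (fun x : H => qmul x q) A.
  by apply: holo_bounded_affine linL kLP _ => p; rewrite chartJ.
have hB : holo_map (fun x : H => qmul x q) J2 B.
  by apply: holo_bounded_affine linB kBP _ => x; rewrite (chart_invJ qq e10 e20 ve1 ve2).
have BD x y : chart_inv q e1 e2 (x + y) = chart_inv q e1 e2 x + chart_inv q e1 e2 y.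
  by have := linB 1 x y; rewrite !scale1r.
have AK : cancel A B by move=> p; rewrite /A /B BD LK addrK.
have LB a b : L (a - b) = L a - L b.
  by have := linL 1 (a - b) b; rewrite !scale1r subrK => ->; rewrite addrK.
have BK' : cancel B A by move=> x; rewrite /A /B LB !BK subrK.
have L0 : L 0 = 0 by have := LB 0 0; rewrite !subrr.
pose O := [set p : V2 | `|L p| < r].
have oO : open O.
  rewrite (_ : O = (fun p => `|L p|) @^-1` [set t | t < r])//.
  apply: open_comp; last exact: open_lt.
  move=> p _; apply: (@continuous_comp _ H); last exact: norm_continuous.
  apply: (@lipschitz_cont R V2 H L kL) => a b.
  by rewrite -LB; exact: kLP.
have O0 : O 0 by rewrite /O /= L0 normr0.
have := @germ_iso_cover R V2 H J2 (fun x => qmul x q) Y X G1 deck p1 quot_pi A B O 0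
  qm1 quotient_map_quot_pi hA hB AK BK' oO O0.
have A0 : A 0 = x0 by rewrite /A L0 add0r.
rewrite A0; apply=> a b Oa Ob; split.
  move=> /(qm_orbit qm1)[g Gg <-]; have [e [eu eh eL]] := H2 _ Gg.
  apply/quot_pi_eq; exists e => //; rewrite /A eL.
  rewrite (_ : _ - _ = x0 - lift_act e x0)// /lift_act qmulDr.
  by move: (qmul _ (L a)) (qmul _ x0) => m1 m2; apply/rowP => i; rewrite !mxE; ring.
move=> /quot_pi_eq[e eu eh].
have /(rP e eu _ _ _ eh) : `|A a - x0| < r by rewrite /A addrK.
have Ab : `|A b - x0| < r by rewrite /A addrK.
move=> /(_ _ Ab); rewrite addrC subrK => /(_ erefl) E.
have eh' : hurwitz (x0 - lift_act e x0) by rewrite -{1}E addrC addKr.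
have [g Gg gL] := H1 _ eu eh'; apply/(qm_orbit qm1); exists g => //.
apply: (can_inj LK); rewrite gL.
move: E; rewrite /A /lift_act qmulDr.
move: (qmul _ (L a)) (qmul _ x0) (L b) (quarter _) => m1 m2 m3 m4 /rowP hr.
by apply/rowP => i; move: (hr i); rewrite !mxE; lra.
Qed.

End LocalModel.

End Gamma.

(** * Points with nontrivial stabilizer *)

(** Four times j/2, the point fixed by ±1 alone. *)
Definition A1pt : int4 := (0, 0, 2, 0).
(** The points p.1 / 4 have the stabilizers {±1, ±p.2}; one point is taken from
each orbit. *)
Definition A3pts : seq (int4 * int4) :=
  [:: ((0, 0, 0, 0), zi); ((1, 1, 1, 1), zk); ((1, 1, 3, 1), zj);
      ((0, 2, 2, 0), zi); ((1, 3, 3, 1), zk); ((3, 1, 1, 1), zj)].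
Definition fixpts : seq int4 := A1pt :: map fst A3pts.

Definition stab (w : int4) : seq int4 :=
  [seq e.1 | e <- Q8lifts & quarter_hurwitz (zsub w (lift_act4 e w))].

Lemma stab_A1 : stab A1pt = [:: z1; zopp z1].
Proof. by vm_compute. Qed.

Lemma stab_A3 : all (fun p : int4 * int4 =>
  (stab p.1 == [:: z1; zopp z1; p.2; zopp p.2]) &&
  (zmul p.2 p.2 == zopp z1)) A3pts.
Proof. by vm_compute. Qed.

Lemma fixpts_distinct : all (fun w => all (fun w' =>
  (w == w') || all (fun e => ~~ quarter_hurwitz (zsub w' (lift_act4 e w))) Q8lifts) fixpts) fixpts.
Proof. by vm_compute. Qed.

(** Four times the halves of Hurwitz quaternions; coefficients 0 and 1 give all
of them modulo Λ. *)
Definition halfpt (a b c d : int) : int4 := (2 * a + d, 2 * b + d, 2 * c + d, d).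

Lemma halfpts_cover : all (fun a => all (fun b => all (fun c => all (fun d =>
  has (fun w => has (fun e => quarter_hurwitz (zsub w (lift_act4 e (halfpt a b c d)))) Q8lifts) fixpts)
  [:: 0; 1]) [:: 0; 1]) [:: 0; 1]) [:: 0; 1 : int].
Proof. by vm_compute. Qed.

(** For u = ±i, ±j, ±k the square of the lift is x |-> -x, up to Λ. *)
Lemma Q8lifts_square : all (fun e => [|| e.1 == z1, e == (zopp z1, (0, 0, 0, 0)) |
  (zmul e.1 e.1 == zopp z1) && quarter_hurwitz (zadd e.2 (zmul e.1 e.2))]) Q8lifts.
Proof. by vm_compute. Qed.

Section Final.
Variable R : realType.
Local Notation C := (Rcomplex R).
Local Notation H := (quat R).
Local Notation V2 := (C * C)%type.
Let J2 (p : V2) : V2 := (('i%C : C) * p.1, ('i%C : C) * p.2).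

Lemma holo_diag (z w : C) : holo_map J2 J2 (fun p : V2 => (z * p.1, w * p.2)).
Proof.
pose D (p : V2) : V2 := (z * p.1, w * p.2).
have -> : (fun p : V2 => (z * p.1, w * p.2)) = (fun p => D p + 0).
  by apply/funext => p; rewrite addr0.
have sc (k : R) (a b : C) : a * (k *: b) = k *: (a * b) by rewrite mulrC -scalerAl mulrC.
apply: (@holo_bounded_affine R V2 V2 J2 J2 D 0 (`|z : C| + `|w : C|)).
- by move=> k p r; rewrite /D; congr pair; rewrite /= mulrDr sc.
- move=> p; rewrite prod_normE /= ge_max !cnormM mulrDl.
  have h1 : `|p.1 : C| <= `|p| by rewrite prod_normE /= le_max lexx.
  have h2 : `|p.2 : C| <= `|p| by rewrite prod_normE /= le_max lexx orbT.
  apply/andP; split.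
    by rewrite (le_trans (ler_wpM2l _ h1))// lerDl mulr_ge0.
  by rewrite (le_trans (ler_wpM2l _ h2))// lerDr mulr_ge0.
by move=> p; rewrite /D /J2 /=; congr pair; rewrite mulrCA.
Qed.

Lemma quotient_map_mu n : quotient_map J2 (@mu_set R n) (orbit_pi (mu R n)).
Proof.
apply: QuotientMap.
- by move=> W; exact: (orbit_openP W).
- by move=> W f; split=> h x Wx; exact: (h x Wx).
- by move=> x y; exact: orbit_piP.
by move=> _ [z _ ->]; exact: holo_diag.
Qed.

Lemma quotient_map_C2 : quotient_map J2 [set id] (id : V2 -> C2 R).
Proof.
apply: QuotientMap.
- by move=> W.
- by move=> W f; split=> h x Wx; exact: (h x Wx).
- by move=> x y; split=> [->|[_ -> ->]//]; exists id.
move=> _ ->; have := @holo_diag 1 1.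
by rewrite (_ : (fun p : V2 => (1 * p.1, 1 * p.2)) = id)//; apply/funext => -[a b]; rewrite /= !mul1r.
Qed.

Lemma qint_unit (v : int4) : zmul v v = zopp z1 -> qmul (qint R v) (qint R v) = - q1 R.
Proof. by move=> vv; rewrite -qint_mul vv qint_opp. Qed.

Variable q : H.
Hypothesis qq : qmul q q = - q1 R.
Local Notation X := (orbit_space (Q8hat q)).
Local Notation quot_pi := (@quot_pi R q).

Lemma eigenvectors (v : int4) : zmul v v = zopp z1 -> exists e1 e2 : H,
  [/\ e1 != 0, e2 != 0, qmul (qint R v) e1 = qmul e1 q & qmul (- qint R v) e2 = qmul e2 q].
Proof.
move=> /qint_unit vv.
have [e1 e10 ve1] := pure_units_conj vv qq.
have [|e2 e20 ve2] := @pure_units_conj R (- qint R v) q _ qq.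
  by rewrite qmulNl qmulNr opprK.
by exists e1, e2.
Qed.

Lemma stabP (w : int4) e : e \in Q8lifts ->
  hurwitz (quarter R w - lift_act e (quarter R w)) -> e.1 \in stab w.
Proof.
move=> eu; rewrite lift_act_quarter -quarter_sub => /quarter_hurwitzP h; apply/mapP; exists e => //.
by rewrite mem_filter h.
Qed.

Lemma stabE (w : int4) u : u \in stab w -> exists2 e, e.1 = u &
  e \in Q8lifts /\ hurwitz (quarter R w - lift_act e (quarter R w)).
Proof.
move=> /mapP[e]; rewrite mem_filter => /andP[h eu] ->; exists e => //; split=> //.
by rewrite lift_act_quarter -quarter_sub; apply/quarter_hurwitzP.
Qed.

Lemma lift_act1 (x : H) : lift_act (z1, (0, 0, 0, 0)) x = x.
Proof.
rewrite lift_actE [qint R z1](_ : _ = q1 R)// qmul1l [quarter _ _](_ : _ = 0) ?addr0//.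
by apply/rowP => -[[|[|[|[|//]]]] ?]; rewrite !mxE /= mul0r.
Qed.

Lemma free_point_smooth (x0 : H) :
  (forall e, e \in Q8lifts -> hurwitz (x0 - lift_act e x0) -> e.1 = z1) ->
  smooth_point (quot_pi x0).
Proof.
move=> st; have [//|e1 [e2 [e10 e20 ve1 ve2]]] := @eigenvectors zi.
apply: (local_model qq e10 e20 ve1 ve2 quotient_map_C2) => //.
  by move=> e eu h; exists id => // p; rewrite (st e eu h) [qint R z1](_ : _ = q1 R)// qmul1l.
move=> _ ->; exists (z1, (0, 0, 0, 0)); split=> //.
  by rewrite lift_act1 subrr; exact: hurwitz0.
by move=> p; rewrite [qint R z1](_ : _ = q1 R)// qmul1l.
Qed.

(** In the coordinates attached to v, the elements ±1, ±i of mu_4 act by left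
multiplication by ±1, ±v. *)
Section Act.
Variables (v : int4) (e1 e2 : H).
Hypotheses (ve1 : qmul (qint R v) e1 = qmul e1 q) (ve2 : qmul (- qint R v) e2 = qmul e2 q).
Local Notation L := (chart q e1 e2).

Lemma act_1 p : L (diag_act 1 p) = qmul (qint R z1) (L p).
Proof.
by rewrite [qint R z1](_ : _ = q1 R)// qmul1l /diag_act invr1 !mul1r; case: p.
Qed.

Lemma cembedN (z : C) : cembed q (- z) = - cembed q z.
Proof. by case: z => a b; rewrite /cembed /= !scaleNr opprD. Qed.

Lemma act_N (z : C) u : (forall p, L (diag_act z p) = qmul (qint R u) (L p)) ->
  forall p, L (diag_act (- z) p) = qmul (qint R (zopp u)) (L p).
Proof.
move=> h p; rewrite qint_opp qmulNl -h /chart /diag_act /= invrN !mulNr !(cembedN, qmulNr).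
by rewrite opprD.
Qed.

Lemma act_i p : L (diag_act ('i%C : C) p) = qmul (qint R v) (L p).
Proof.
have iV : ('i%C : C)^-1 = - ('i%C : C).
  by apply/eqP; rewrite eq_complex /=; apply/andP; split; apply/eqP; field.
rewrite /chart /diag_act /= iV mulNr cembedN !(cembed_i qq) -!(cembed_comm qq).
by rewrite qmulNr qmulDr !qmulA ve1 -ve2 !qmulNl opprK.
Qed.
End Act.

Lemma A1_point : A_point 1 (quot_pi (quarter R A1pt)).
Proof.
have [//|e1 [e2 [e10 e20 ve1 ve2]]] := @eigenvectors zi.
have a1 := @act_1 e1 e2; have aN := act_N a1.
apply: (local_model qq e10 e20 ve1 ve2 (quotient_map_mu 1)) => //.
  move=> e eu /(stabP eu); rewrite stab_A1 !inE => /orP[] /eqP ->.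
    by exists (diag_act 1) => //; exists 1 => //; rewrite expr1n.
  by exists (diag_act (- 1)) => //; exists (- 1) => //; rewrite sqrrN expr1n.
move=> _ [z z2 ->].
have zz : z = 1 \/ z = - 1.
  have : (z - 1) * (z + 1) = 0 by rewrite -subr_sqr z2 expr1n subrr.
  by move/eqP; rewrite mulf_eq0 subr_eq0 addr_eq0 => /orP[] /eqP; tauto.
have S u : u \in [:: z1; zopp z1] -> exists2 e, e.1 = u &
    e \in Q8lifts /\ hurwitz (quarter R A1pt - lift_act e (quarter R A1pt)).
  by rewrite -stab_A1; exact: stabE.
case: zz => ->.
  by have [e eE [eu h]] := S z1 isT; exists e; rewrite eE.
by have [e eE [eu h]] := S (zopp z1) isT; exists e; rewrite eE.
Qed.

Lemma A3_points (p : int4 * int4) : p \in A3pts -> A_point 3 (quot_pi (quarter R p.1)).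
Proof.
move=> /(allP stab_A3)/andP[/eqP st /eqP vv].
have [e1 [e2 [e10 e20 ve1 ve2]]] := eigenvectors vv.
have a1 := @act_1 e1 e2; have aN := act_N a1.
have ai := act_i ve1 ve2; have aiN := act_N ai.
have i2 : ('i%C : C) ^+ 2 = - 1 by exact: sqr_i.
have i4 : ('i%C : C) ^+ 4 = 1 by rewrite (exprM _ 2 2) i2 sqrrN expr1n.
apply: (local_model qq e10 e20 ve1 ve2 (quotient_map_mu 3)) => //.
  move=> e eu /(stabP eu); rewrite st !inE => /or4P[] /eqP ->.
  - by exists (diag_act 1) => //; exists 1 => //; rewrite expr1n.
  - by exists (diag_act (- 1)) => //; exists (- 1) => //; rewrite (exprM _ 2 2) sqrrN !expr1n.
  - by exists (diag_act 'i%C) => //; exists ('i%C : C).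
  - by exists (diag_act (- ('i%C : C))) => //; exists (- ('i%C : C)) => //; rewrite (exprM _ 2 2) sqrrN -exprM.
move=> _ [z z4 ->].
have zz : [\/ z = 1, z = - 1, z = 'i%C | z = - ('i%C : C)].
  have : (z - 1) * (z + 1) * ((z - 'i%C) * (z + 'i%C)) = 0.
    transitivity (z ^+ 4 - 1); last by rewrite z4 subrr.
    by rewrite -!subr_sqr expr1n i2; ring.
  move/eqP; rewrite !mulf_eq0 !subr_eq0 !addr_eq0.
  case/orP=> /orP[] /eqP ->; [exact: Or41|exact: Or42|exact: Or43|exact: Or44].
have S u : u \in [:: z1; zopp z1; p.2; zopp p.2] -> exists2 e, e.1 = u &
    e \in Q8lifts /\ hurwitz (quarter R p.1 - lift_act e (quarter R p.1)).
  by rewrite -st; exact: stabE.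
case: zz => ->.
- by have [|e eE [eu h]] := S z1; [rewrite !inE eqxx|exists e; rewrite eE].
- by have [|e eE [eu h]] := S (zopp z1); [rewrite !inE eqxx ?orbT|exists e; rewrite eE].
- by have [|e eE [eu h]] := S p.2; [rewrite !inE eqxx ?orbT|exists e; rewrite eE].
- by have [|e eE [eu h]] := S (zopp p.2); [rewrite !inE eqxx ?orbT|exists e; rewrite eE].
Qed.

Lemma A_point_singular (n : nat) (x : X) : odd n -> A_point n x -> singular_point x.
Proof.
move=> on Ax Sx; apply: (@cyclic_singular R n on).
apply: germ_iso_join Ax Sx.
by apply: orbit_local; apply: orbit_local; exact: flat_local.
Qed.

(** The lift e with unit -1 is x |-> -x, and the squares of the others are this
map modulo Λ; its fixed points have 2 x in Λ. *)
Lemma fixed_half_lattice (x0 : H) e : e \in Q8lifts -> e.1 != z1 ->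
  hurwitz (x0 - lift_act e x0) -> hurwitz (x0 + x0).
Proof.
move=> eu ne; have := allP Q8lifts_square e eu; rewrite (negbTE ne) orFb.
case/orP=> [/eqP ->|/andP[/eqP uu lc]] h.
  move: h; rewrite -[lift_act _ _]/(lift_act (zopp z1, (0, 0, 0, 0)) x0) lift_actE qint_opp [qint R z1](_ : _ = q1 R)// qmulNl qmul1l.
  rewrite [quarter _ _](_ : _ = 0) ?addr0 ?opprK//.
  by apply/rowP => -[[|[|[|[|//]]]] ?]; rewrite !mxE /= mul0r.
have hc : hurwitz (quarter R e.2 + qmul (qint R e.1) (quarter R e.2)).
  by rewrite -quarter_mul -quarter_add; apply/quarter_hurwitzP.
have hu := qint_hurwitz e.1 h.
have := hurwitzD (hurwitzD h hu) hc; congr hurwitz.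
rewrite /lift_act qmulBr qmulDr (qmulA _ _ x0) -qint_mul uu qint_opp [qint R z1](_ : _ = q1 R)// qmulNl qmul1l.
move: (qmul _ x0) (quarter _ _) (qmul _ (quarter _ _)) => m1 m2 m3.
by apply/rowP => i; rewrite !mxE; ring.
Qed.

Lemma half_lattice_fixpts (x0 : H) : hurwitz (x0 + x0) ->
  exists2 w, w \in fixpts & quot_pi x0 = quot_pi (quarter R w).
Proof.
move=> /hurwitzP[a [b [c [d h]]]].
have x0E : x0 = quarter R (halfpt a b c d).
  have -> : x0 = 2^-1 *: (x0 + x0) by apply/rowP => i; rewrite !mxE; field.
  by rewrite h quatZ /quarter /halfpt !intrD !intrM; congr Quat; field.
have m2 (n : int) : (n %% 2)%Z \in [:: 0; 1 : int].
  have := modz_ge0 n (isT : (2 : int) != 0); have := ltz_pmod n (isT : (0 : int) < 2).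
  by case: (n %% 2)%Z => [[|[|m]]|m].
have := halfpts_cover.
move=> /allP/(_ _ (m2 a))/allP/(_ _ (m2 b))/allP/(_ _ (m2 c))/allP/(_ _ (m2 d)).
set w0 := halfpt _ _ _ _ => /hasP[w wf /hasP[e eu lw]]; exists w => //.
(* Reducing the coefficients modulo 2 moves the point by an element of the
   lattice. *)
have -> : quot_pi x0 = quot_pi (quarter R w0).
  apply/quot_pi_eq; exists (z1, (0, 0, 0, 0)) => //.
  rewrite lift_act1 x0E -quarter_sub; apply/quarter_hurwitzP.
  rewrite /w0 /zsub /halfpt /zadd /zopp /quarter_hurwitz.
  move: (divz_eq a 2) (divz_eq b 2) (divz_eq c 2) (divz_eq d 2).
  move: (a %/ 2)%Z (a %% 2)%Z (b %/ 2)%Z (b %% 2)%Z (c %/ 2)%Z (c %% 2)%Z (d %/ 2)%Z (d %% 2)%Z.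
  move=> a' a0 b' b0 c' c0 d' d0 -> -> -> ->.
  have E (x y u v : int) : 2 * x + u + - (2 * (y * 2 + x) + (v * 2 + u)) -
      (u + - (v * 2 + u)) = - y * 4 by ring.
  rewrite !E !dvdz_mull//=.
  by rewrite (_ : d0 + _ = - d' * 2) ?dvdz_mull//; ring.
by apply/quot_pi_eq; exists e => //; rewrite lift_act_quarter -quarter_sub; apply/quarter_hurwitzP.
Qed.

Lemma fixpts_inj w w' : w \in fixpts -> w' \in fixpts ->
  quot_pi (quarter R w) = quot_pi (quarter R w') -> w = w'.
Proof.
move=> wf wf' /quot_pi_eq[e eu]; rewrite lift_act_quarter -quarter_sub => /quarter_hurwitzP h.
have := fixpts_distinct => /allP/(_ _ wf)/allP/(_ _ wf')/orP[/eqP//|].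
by move=> /allP/(_ _ eu); rewrite h.
Qed.

End Final.

Theorem lemma18 (R : realType) (q : quat R) (hq : qmul q q = - q1 R) :
  exists (p : orbit_space (Q8hat q)) (s : 'I_6 -> orbit_space (Q8hat q)),
    [/\ injective s,
        forall l, s l <> p,
        A_point 1 p,
        forall l, A_point 3 (s l) &
        [set x : orbit_space (Q8hat q) | singular_point x] = p |` range s].
Proof.
pose wl (l : 'I_6) := (nth (A1pt, A1pt) A3pts l).1.
have wlf (l : 'I_6) : nth (A1pt, A1pt) A3pts l \in A3pts.
  by rewrite mem_nth//; case: l.
have wlf' l : wl l \in fixpts by rewrite inE (map_f fst (wlf l)) orbT.
have A1f : A1pt \in fixpts by rewrite inE eqxx.
have A1_3 l : wl l <> A1pt.
  by move=> E; have := map_f fst (wlf l); rewrite -/(wl l) E.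
exists (quot_pi q (quarter R A1pt)), (fun l => quot_pi q (quarter R (wl l))).
have A1P : A_point 1 (quot_pi q (quarter R A1pt)) by exact: A1_point.
have A3P l : A_point 3 (quot_pi q (quarter R (wl l))) by exact: (A3_points hq (wlf l)).
split=> //.
- move=> l l' /(fixpts_inj (wlf' l) (wlf' l')) E; apply/val_inj/eqP.
  have um : uniq (map fst A3pts) by [].
  have E' l1 : wl l1 = nth A1pt (map fst A3pts) l1.
    by rewrite (nth_map (A1pt, A1pt)).
  have hs (l1 : 'I_6) : (l1 < size (map fst A3pts))%N by case: l1.
  by have := nth_uniq A1pt (hs l) (hs l') um; rewrite -!E' E eqxx => <-.
- by move=> l /(fixpts_inj (wlf' l) A1f); exact: A1_3.
apply/seteqP; split=> x; last first.
  by case=> [->|[l _ <-]]; [exact: A_point_singular A1P|exact: A_point_singular (A3P l)].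
move=> Sx.
have [x0 xE] : exists x0, x = quot_pi q x0.
  by exists (orbit_repr (orbit_repr x)); rewrite /quot_pi !orbit_reprK.
have [st|N] := pselect (forall e, e \in Q8lifts -> hurwitz (x0 - lift_act e x0) -> e.1 = z1).
  by exfalso; apply: Sx; rewrite xE; exact: free_point_smooth.
have [e [eu ne h]] : exists e, [/\ e \in Q8lifts, e.1 != z1 & hurwitz (x0 - lift_act e x0)].
  apply: contrapT => N'; apply: N => e eu h; apply/eqP/negPn/negP => ne.
  by apply: N'; exists e.
have [w wf xw] := half_lattice_fixpts q (fixed_half_lattice eu ne h).
rewrite xE xw; move: wf; rewrite inE => /predU1P[->|/mapP[p pA ->]]; first by left.
right; have pi6 : (index p A3pts < 6)%N by rewrite index_mem.
by exists (Ordinal pi6); rewrite // /wl nth_index.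
Qed.
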